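(* Let $k$ be a field, let $(\mathcal{H}_1,\mu_1,\eta_1,\Delta_1,\varepsilon_1,S_1)$ be an $m_1$-inverse property Hopf quasigroup over $k$ such that $S_1(\delta_1)=\delta_1$ and $S_1^{h_1}\in\mathrm{Aut}(\mathcal{H}_1)$, and let $(\mathcal{H}_2,\mu_2,\eta_2,\Delta_2,\varepsilon_2,S_2)$ be an $m_2$-inverse property Hopf quasigroup such that $S_2(\delta_2)=\delta_2$ and $S_2^{h_2}\in\mathrm{Aut}(\mathcal{H}_2)$, where $\delta_i=\eta_i(1)$ and $m_i,h_i\in\mathbb{Z}$. Let $\phi:\mathcal{H}_2\otimes\mathcal{H}_1\to\mathcal{H}_1$ and $\psi:\mathcal{H}_2\otimes\mathcal{H}_1\to\mathcal{H}_2$ be linear maps satisfying, for all $h,g\in\mathcal{H}_1$, all $h'\in\mathcal{H}_2$, and all $m\in\mathbb{Z}$ with $m\equiv m_1\ (\mathrm{mod}\ h_1)$ and $m\equiv m_2\ (\mathrm{mod}\ h_2)$: (1) $\phi(\delta_2,h)=h$, $\phi(h',\delta_1)=\varepsilon_2(h')\delta_1$, $\psi(\delta_2,h)=\varepsilon_1(h)\delta_2$, $\psi(h',\delta_1)=h'$; (2) $\phi(S_2(h'_{(1)}),\phi(h'_{(2)},h))=\varepsilon_2(h')h=\phi(h'_{(1)},\phi(S_2(h'_{(2)}),h))$; (3) $\psi\big(\psi(h',S_1^m(h_{(2)}g)),S_1^{m+1}(h_{(1)})\big)=\varepsilon_1(h)\psi(h',S_1^m(g))$; (4) $\psi(\psi(h',S_1(h_{(1)})),h_{(2)})=\varepsilon_1(h)h'=\psi(\psi(h',h_{(1)}),S_1(h_{(2)}))$;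 (5) $\Delta_1(\phi(h',h))=\phi(h'_{(1)},h_{(1)})\otimes\phi(h'_{(2)},h_{(2)})$ and $\varepsilon_1(\phi(h',h))=\varepsilon_1(h)\varepsilon_2(h')$; (6) $\Delta_2(\psi(h',h))=\psi(h'_{(1)},h_{(1)})\otimes\psi(h'_{(2)},h_{(2)})$ and $\varepsilon_2(\psi(h',h))=\varepsilon_1(h)\varepsilon_2(h')$; (7) $\varepsilon_1(h)\phi(h',S_1^m(g))$ equals $\phi(h'_{(1)},S_1^m(h_{(3)}g_{(2)}))\,\phi\big(\psi(h'_{(2)},S_1^m(h_{(2)}g_{(1)})),S_1^{m+1}(h_{(1)})\big)$ if $m$ is odd, and equals $\phi(h'_{(1)},S_1^m(h_{(2)}g_{(1)}))\,\phi\big(\psi(h'_{(2)},S_1^m(h_{(3)}g_{(2)})),S_1^{m+1}(h_{(1)})\big)$ if $m$ is even; (8) $\phi(h'_{(1)},S_1(h_{(2)}))\,\phi(\psi(h'_{(2)},S_1(h_{(1)})),h_{(3)})=\varepsilon_1(h)\varepsilon_2(h')\delta_1=\phi(h'_{(1)},h_{(1)})\,\phi(\psi(h'_{(2)},h_{(2)}),S_1(h_{(3)}))$; (9) $\psi(S_2(h'_{(1)}),\phi(h'_{(2)},h_{(1)}))\,\psi(h'_{(3)},h_{(2)})=\varepsilon_1(h)\varepsilon_2(h')\delta_2=\psi(h'_{(1)},\phi(S_2(h'_{(3)}),h_{(1)}))\,\psi(S_2(h'_{(2)}),h_{(2)})$; (10) $\psi(h'_{(1)},h_{(1)})\otimes\phi(h'_{(2)},h_{(2)})=\psi(h'_{(2)},h_{(2)})\otimes\phi(h'_{(1)},h_{(1)})$.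 Then, for such $m$, the space $\mathcal{H}_1\bowtie\mathcal{H}_2:=\mathcal{H}_1\otimes\mathcal{H}_2$, with the tensor product unit $\eta_\otimes$, the tensor product coalgebra structure $(\Delta_\otimes,\varepsilon_\otimes)$, the multiplication $$(h\otimes h')(g\otimes g'):=h\,\phi(h'_{(1)},g_{(1)})\otimes\psi(h'_{(2)},g_{(2)})\,g',$$ and the antipode $$S_{\bowtie}(h\otimes h'):=(\delta_1\otimes S_2(h'))(S_1(h)\otimes\delta_2)=\phi\big(S_2(h'_{(2)}),S_1(h_{(2)})\big)\otimes\psi\big(S_2(h'_{(1)}),S_1(h_{(1)})\big),$$ is an $m$-inverse property Hopf quasigroup if and only if the following holds for all $h,g\in\mathcal{H}_1$ and all $h',g'\in\mathcal{H}_2$: - if $m$ is even: $\phi(h',h)=\varepsilon_2(h')h$ and $\psi(h',h)=\varepsilon_1(h)h'$; - if $m$ is odd: $$\phi\big(S_2^m(\psi(h'_{(2)},g_{(2)})g'),\,S_1^m(\phi(h'_{(1)},g_{(1)}))\big)=\varepsilon_2(h')\,\phi(S_2^m(g'),S_1^m(g))$$ and $$\psi\big(S_2^m(\psi(h'_{(3)},g_{(2)})g'),\,S_1^m(\phi(h'_{(2)},g_{(1)}))\big)\,S_2^{m+1}(h'_{(1)})=\varepsilon_2(h')\,\psi(S_2^m(g'),S_1^m(g)).$$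
   Context: Sweedler notation $\Delta(h)=h_{(1)}\otimes h_{(2)}$ (summation suppressed) is used; $\phi(h',h)$ means $\phi(h'\otimes h)$, similarly for $\psi$. For $m\in\mathbb{Z}$, an $m$-inverse property Hopf quasigroup (also called $m$-invertible or $m$-inverse Hopf quasigroup) over $k$ is a $k$-linear space $\mathcal{H}$ with linear maps $\mu:\mathcal{H}\otimes\mathcal{H}\to\mathcal{H}$, $\eta:k\to\mathcal{H}$, $\Delta:\mathcal{H}\to\mathcal{H}\otimes\mathcal{H}$, $\varepsilon:\mathcal{H}\to k$, $S:\mathcal{H}\to\mathcal{H}$ such that, with $\delta:=\eta(1)$: (i) $(\mathcal{H},\mu,\eta)$ is a unital, not necessarily associative algebra; (ii) $(\mathcal{H},\Delta,\varepsilon)$ is a coassociative counital coalgebra; (iii) $\Delta$ and $\varepsilon$ are multiplicative; (iv) $S$ is the unique coalgebra anti-automorphism (bijective, $\Delta(S(h))=S(h_{(2)})\otimes S(h_{(1)})$, $\varepsilon\circ S=\varepsilon$) satisfying $h_{(1)}S(h_{(2)})=\varepsilon(h)\delta=S(h_{(1)})h_{(2)}$ for all $h$, and moreover $S^m(h_{(2)}g)\,S^{m+1}(h_{(1)})=\varepsilon(h)S^m(g)$ for all $h,g\in\mathcal{H}$. $S^r\in\mathrm{Aut}(\mathcal{H})$ means $S^r(hg)=S^r(h)S^r(g)$ and $\Delta(S^r(h))=S^r(h_{(1)})\otimes S^r(h_{(2)})$ for all $h,g\in\mathcal{H}$. Tensor product structure: $\eta_\otimes(\alpha)=\alpha\,\delta_1\otimes\delta_2$,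 $\Delta_\otimes(h\otimes h')=(h_{(1)}\otimes h'_{(1)})\otimes(h_{(2)}\otimes h'_{(2)})$, $\varepsilon_\otimes(h\otimes h')=\varepsilon_1(h)\varepsilon_2(h')$. *)

(* Defs.v *)
From HB Require Import structures.
From mathcomp Require Import all_boot all_order all_algebra.
From mathcomp Require Import generic_quotient boolp classical_sets.

Set Implicit Arguments.
Unset Strict Implicit.
Unset Printing Implicit Defensive.

Import GRing.Theory.
Local Open Scope ring_scope.

Reserved Notation "U ⊗ V" (at level 40, left associativity).
Reserved Notation "\tsum_ ( u , v <- t ) F"
  (at level 36, u name, v name, t at level 36, F at level 36, right associativity,
   format "'[' \tsum_ ( u ,  v  <-  t ) '/  '  F ']'").
Reserved Notation "\sw[ A ]_ ( u , v <- h ) F"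
  (at level 36, u name, v name, A at level 36, h at level 36, F at level 36,
   right associativity,
   format "'[' \sw[ A ]_ ( u ,  v  <-  h ) '/  '  F ']'").
Reserved Notation "\sw[ A ]_ ( u , v , w <- h ) F"
  (at level 36, u name, v name, w name, A at level 36, h at level 36, F at level 36,
   right associativity,
   format "'[' \sw[ A ]_ ( u ,  v ,  w  <-  h ) '/  '  F ']'").
Reserved Notation "x *_[ A ] y" (at level 40, left associativity,
   format "x  *_[ A ]  y").

(* A finite list [:: (u1, v1); ...; (un, vn)] stands for the formal sum
   u1 ⊗ v1 + ... + un ⊗ vn; [tens_rel] is the congruence on the monoid of lists
   generated by commutativity and bilinearity. The additive inverse of u ⊗ v is
   (- u) ⊗ v, so the quotient monoid is the usual tensor product. *)

Inductive tens_rel (k : fieldType) (U V : lmodType k) :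
    seq (U * V) -> seq (U * V) -> Prop :=
  | tens_refl s : tens_rel s s
  | tens_sym s t : tens_rel s t -> tens_rel t s
  | tens_trans s t r : tens_rel s t -> tens_rel t r -> tens_rel s r
  | tens_cat s s' t t' :
      tens_rel s s' -> tens_rel t t' -> tens_rel (s ++ t) (s' ++ t')
  | tens_swap s t : tens_rel (s ++ t) (t ++ s)
  | tens_addl u u' v : tens_rel [:: (u + u', v)] [:: (u, v); (u', v)]
  | tens_addr u v v' : tens_rel [:: (u, v + v')] [:: (u, v); (u, v')]
  | tens_scale a u v : tens_rel [:: (a *: u, v)] [:: (u, a *: v)]
  | tens_zero v : tens_rel [:: (0, v)] [::].

Section Tensor.
Variables (k : fieldType) (U V : lmodType k).
Implicit Types (s t : seq (U * V)) (W : lmodType k).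

Definition tens_eqv s t := `[< tens_rel s t >].

Lemma tens_eqv_refl : reflexive tens_eqv.
Proof. by move=> s; apply/asboolP/tens_refl. Qed.

Lemma tens_eqv_sym : symmetric tens_eqv.
Proof. by move=> s t; apply/asboolP/asboolP; apply: tens_sym. Qed.

Lemma tens_eqv_trans : transitive tens_eqv.
Proof.
by move=> s t r /asboolP ts /asboolP sr; apply/asboolP/(tens_trans ts).
Qed.

Canonical tens_equiv :=
  EquivRel tens_eqv tens_eqv_refl tens_eqv_sym tens_eqv_trans.

Definition tensor : Type := {eq_quot tens_equiv}%qT.
HB.instance Definition _ := Choice.on tensor.

Definition tcls s : tensor := (\pi_({eq_quot tens_equiv}))%qT s.
Definition trepr (x : tensor) : seq (U * V) := repr (x : {eq_quot tens_equiv}%qT).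

Lemma treprK x : tcls (trepr x) = x.
Proof. exact: reprK. Qed.

Lemma tcls_eq s t : tens_rel s t -> tcls s = tcls t.
Proof. by move=> st; apply/eqmodP/asboolP. Qed.

Lemma trepr_cls s : tens_rel (trepr (tcls s)) s.
Proof. by apply/asboolP; apply/(@eqmodP _ tens_equiv); rewrite reprK. Qed.

Definition scale_seq a s := [seq (a *: p.1, p.2) | p <- s].

Lemma tens_rel_scale a s t :
  tens_rel s t -> tens_rel (scale_seq a s) (scale_seq a t).
Proof.
elim=> {s t} /=.
- by move=> s; apply: tens_refl.
- by move=> s t _; apply: tens_sym.
- by move=> s t r _ st _; apply: tens_trans.
- by move=> s s' t t' _ ss _ tt; rewrite /scale_seq !map_cat; apply: tens_cat.
- by move=> s t; rewrite /scale_seq !map_cat; apply: tens_swap.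
- by move=> u u' v; rewrite scalerDr; apply: tens_addl.
- by move=> u v v'; apply: tens_addr.
- by move=> b u v; rewrite scalerA mulrC -scalerA; apply: tens_scale.
- by move=> v; rewrite scaler0; apply: tens_zero.
Qed.

Lemma tens_rel_scaleD a b s :
  tens_rel (scale_seq (a + b) s) (scale_seq a s ++ scale_seq b s).
Proof.
elim: s => [|[u v] s IHs] /=; first exact: tens_refl.
rewrite scalerDl -cat1s.
apply: tens_trans (tens_cat (tens_addl _ _ _) IHs) _ => /=.
rewrite -cat1s -[X in tens_rel _ X]cat1s; apply: tens_cat; first exact: tens_refl.
rewrite -[_ :: scale_seq b s]cat1s -cat1s !catA; apply: tens_cat.
  exact: tens_swap.
exact: tens_refl.
Qed.

Lemma tens_rel_scale0 s : tens_rel (scale_seq 0 s) [::].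
Proof.
elim: s => [|[u v] s IHs] /=; first exact: tens_refl.
rewrite scale0r -cat1s -[[::]]/([::] ++ [::]).
by apply: tens_cat => //; apply: tens_zero.
Qed.

Definition tens_zero_elt := tcls [::].
Definition tens_add x y := tcls (trepr x ++ trepr y).
Definition tens_scal a x := tcls (scale_seq a (trepr x)).
Definition tens_opp := tens_scal (-1).

Lemma tens_addE s t : tens_add (tcls s) (tcls t) = tcls (s ++ t).
Proof. by apply: tcls_eq; apply: tens_cat; apply: trepr_cls. Qed.

Lemma tens_scalE a s : tens_scal a (tcls s) = tcls (scale_seq a s).
Proof. by apply: tcls_eq; apply/tens_rel_scale/trepr_cls. Qed.

Lemma tens_addA : associative tens_add.
Proof.
move=> x y z; rewrite -(treprK x) -(treprK y) -(treprK z).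
by rewrite !tens_addE catA.
Qed.

Lemma tens_addC : commutative tens_add.
Proof. by move=> x y; apply: tcls_eq; apply: tens_swap. Qed.

Lemma tens_add0 : left_id tens_zero_elt tens_add.
Proof. by move=> x; rewrite -{1}(treprK x) tens_addE treprK. Qed.

Lemma tens_scalDl x : {morph tens_scal^~ x : a b / a + b >-> tens_add a b}.
Proof.
by move=> a b; rewrite -(treprK x) !tens_scalE tens_addE;
  apply/tcls_eq/tens_rel_scaleD.
Qed.

Lemma tens_scal1 : left_id 1 tens_scal.
Proof.
move=> x; rewrite -(treprK x) tens_scalE; congr tcls.
by rewrite -[RHS]map_id; apply: eq_map => -[u v]; rewrite /= scale1r.
Qed.

Lemma tens_scal0 x : tens_scal 0 x = tens_zero_elt.
Proof. by rewrite -(treprK x) tens_scalE; apply/tcls_eq/tens_rel_scale0. Qed.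

Lemma tens_addN : left_inverse tens_zero_elt tens_opp tens_add.
Proof.
by move=> x; rewrite -{2}[x]tens_scal1 -tens_scalDl addNr tens_scal0.
Qed.

HB.instance Definition _ :=
  GRing.isZmodule.Build tensor tens_addA tens_addC tens_add0 tens_addN.

Lemma tens_scalA a b x : tens_scal a (tens_scal b x) = tens_scal (a * b) x.
Proof.
rewrite -(treprK x) !tens_scalE; congr tcls.
by rewrite /scale_seq -map_comp; apply: eq_map => p /=; rewrite scalerA.
Qed.

Lemma tens_scalDr : right_distributive tens_scal +%R.
Proof.
move=> a x y; rewrite -(treprK x) -(treprK y).
rewrite /GRing.add /= tens_addE !tens_scalE tens_addE.
by rewrite /scale_seq map_cat.
Qed.

HB.instance Definition _ := GRing.Zmodule_isLmodule.Build k tensor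
  tens_scalA tens_scal1 tens_scalDr tens_scalDl.

Definition tens (u : U) (v : V) : tensor := tcls [:: (u, v)].

(* Sweedler-style summation: write t = \sum_i u_i ⊗ v_i for a chosen
   representative and form \sum_i f u_i v_i. For bilinear f the choice does not
   matter, and [tsum f] is the linear map induced by f; see [tsumE] and
   [linear_tsum]. *)
Definition tsum (W : lmodType k) (f : U -> V -> W) (t : tensor) : W :=
  \sum_(p <- trepr t) f p.1 p.2.

End Tensor.

Notation "U ⊗ V" := (tensor U%type V%type) : type_scope.
Notation "u ⊗ v" := (tens u v) : ring_scope.
Notation "\tsum_ ( u , v <- t ) F" := (tsum (fun u v => F) t) : ring_scope.

Section TensorTheory.
Variables (k : fieldType) (U V : lmodType k).

Lemma linear_tensl (v : V) : linear (fun u : U => u ⊗ v).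
Proof.
move=> a u u'; rewrite /GRing.scale /= tens_scalE /GRing.add /= tens_addE.
exact/tcls_eq/tens_addl.
Qed.

Lemma linear_tensr (u : U) : linear (fun v : V => u ⊗ v).
Proof.
move=> a v v'; rewrite /GRing.scale /= tens_scalE /GRing.add /= tens_addE /=.
apply: tcls_eq; apply: tens_trans (tens_addr _ _ _) _.
rewrite -cat1s -[X in tens_rel _ X]cat1s.
by apply: tens_cat; [apply/tens_sym/tens_scale|apply: tens_refl].
Qed.

Lemma tensor_sum (t : U ⊗ V) : t = \tsum_(u, v <- t) (u ⊗ v).
Proof.
rewrite /tsum -{1}(treprK t); elim: (trepr t) => [|p s IHs].
  by rewrite big_nil.
by rewrite big_cons -IHs -cat1s -tens_addE; case: p.
Qed.

Lemma raw_linear0 (Z W : lmodType k) (g : Z -> W) : linear g -> g 0 = 0.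
Proof. by move=> /(_ (-1) 0 0); rewrite scaler0 addr0 scaleN1r addNr. Qed.

Lemma raw_linearZ (Z W : lmodType k) (g : Z -> W) a z :
  linear g -> g (a *: z) = a *: g z.
Proof.
by move=> ling; have := ling a z 0; rewrite (raw_linear0 ling) !addr0.
Qed.

Variables (W : lmodType k) (f : U -> V -> W).
Hypothesis linl : forall v, linear (f^~ v).
Hypothesis linr : forall u, linear (f u).

Lemma tens_rel_sum s t : tens_rel s t ->
  \sum_(p <- s) f p.1 p.2 = \sum_(p <- t) f p.1 p.2.
Proof.
elim=> {s t} //=.
- by move=> s t r _ -> _ ->.
- by move=> s s' t t' _ ss _ tt; rewrite !big_cat /= ss tt.
- by move=> s t; rewrite !big_cat /= addrC.
- move=> u u' v; rewrite !big_cons !big_nil /= !addr0.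
  by have := linl v 1 u u'; rewrite !scale1r.
- move=> u v v'; rewrite !big_cons !big_nil /= !addr0.
  by have := linr u 1 v v'; rewrite !scale1r.
- move=> a u v; rewrite !big_cons !big_nil /= !addr0.
  by rewrite (raw_linearZ a u (linl v)) (raw_linearZ a v (linr u)).
- move=> v; rewrite big_cons !big_nil /= addr0.
  exact: (raw_linear0 (linl v)).
Qed.

Lemma tsumE u v : tsum f (u ⊗ v) = f u v.
Proof. by rewrite /tsum (tens_rel_sum (trepr_cls _)) big_seq1. Qed.

Lemma linear_tsum : linear (tsum f).
Proof.
move=> a x y; rewrite /tsum.
have -> : a *: x + y = tcls (scale_seq a (trepr x) ++ trepr y).
  by rewrite -tens_addE treprK.
rewrite (tens_rel_sum (trepr_cls _)) big_cat /= big_map /= scaler_sumr.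
congr (_ + _); apply: eq_bigr => p _.
exact: (raw_linearZ _ _ (linl p.2)).
Qed.

End TensorTheory.

Lemma linear_tsum_body (k : fieldType) (U V W Z : lmodType k)
    (f : Z -> U -> V -> W) (t : U ⊗ V) :
  (forall u v, linear (fun z => f z u v)) -> linear (fun z => tsum (f z) t).
Proof.
move=> linf a x y; rewrite /tsum scaler_sumr -big_split /=.
by apply: eq_bigr => p _; apply: linf.
Qed.

Lemma linear_tsum_arg (k : fieldType) (U V W Z : lmodType k)
    (f : U -> V -> W) (g : Z -> U ⊗ V) :
  (forall v, linear (f^~ v)) -> (forall u, linear (f u)) -> linear g ->
  linear (fun z => tsum f (g z)).
Proof. by move=> linl linr ling a x y; rewrite ling linear_tsum. Qed.

Lemma linear_tens_argl (k : fieldType) (U V Z : lmodType k) (g : Z -> U) (v : V) :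
  linear g -> linear (fun z => g z ⊗ v).
Proof. by move=> ling a x y; rewrite ling linear_tensl. Qed.

Lemma linear_tens_argr (k : fieldType) (U V Z : lmodType k) (u : U) (g : Z -> V) :
  linear g -> linear (fun z => u ⊗ g z).
Proof. by move=> ling a x y; rewrite ling linear_tensr. Qed.

Lemma linear_app (k : fieldType) (Z V W : lmodType k) (F : {linear V -> W})
    (g : Z -> V) :
  linear g -> linear (fun z => F (g z)).
Proof. by move=> ling a x y; rewrite ling linearP. Qed.

Lemma linear_var (k : fieldType) (Z : lmodType k) : linear (fun z : Z => z).
Proof. by []. Qed.

Ltac solve_linear :=
  intros; cbv beta;
  lazymatch goal with
  | |- GRing.linear_for _ (fun z => z) => exact: linear_var
  | |- GRing.linear_for _ (fun z => tsum (@?f z) (@?g z)) =>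
      match f with
      | (fun _ => ?f0) => apply: (@linear_tsum_arg _ _ _ _ _ f0 g)
      | _ => match g with
             | (fun _ => ?t) => apply: (@linear_tsum_body _ _ _ _ _ f t)
             end
      end; solve_linear
  | |- GRing.linear_for _ (fun z => tens (@?f z) (@?g z)) =>
      match f with
      | (fun _ => ?u) => apply: (@linear_tens_argr _ _ _ _ u g)
      | _ => match g with
             | (fun _ => ?v) => apply: (@linear_tens_argl _ _ _ _ f v)
             end
      end; solve_linear
  | |- GRing.linear_for _ (fun z => GRing.Linear.sort ?F (@?g z)) =>
      apply: (@linear_app _ _ _ _ F g); solve_linear
  end.

Record hopf_ops (k : fieldType) (H : lmodType k) := HopfOps {
  hmul : {linear (H ⊗ H)%type -> H};
  hunit : {linear k^o -> H};
  hcomul : {linear H -> (H ⊗ H)%type};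
  hcounit : {linear H -> k^o};
  hantip : {linear H -> H}
}.

Definition delta (k : fieldType) (H : lmodType k) (A : hopf_ops H) : H :=
  hunit A 1.

Notation "x *_[ A ] y" := (hmul A (x ⊗ y)) : ring_scope.
Notation "\sw[ A ]_ ( u , v <- h ) F" :=
  (tsum (fun u v => F) (hcomul A h)) : ring_scope.
Notation "\sw[ A ]_ ( u , v , w <- h ) F" :=
  (tsum (fun u vw => tsum (fun v w => F) (hcomul A vw)) (hcomul A h)) : ring_scope.

(* The two-sided inverse of S, when S is bijective. *)
Definition fun_inv (k : fieldType) (H : lmodType k) (S : H -> H) (y : H) : H :=
  xget 0 [set x | S x = y]%classic.

Lemma fun_invK (k : fieldType) (H : lmodType k) (S : H -> H) :
  bijective S -> cancel S (fun_inv S) /\ cancel (fun_inv S) S.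
Proof.
case=> T ST TS; have K : cancel (fun_inv S) S.
  by move=> y; rewrite /fun_inv; case: xgetP => // /(_ (T y)) /=; rewrite TS.
by split=> // x; apply: (can_inj ST); rewrite K.
Qed.

Definition zpow (k : fieldType) (H : lmodType k) (S : H -> H) (m : int) : H -> H :=
  match m with
  | Posz n => iter n S
  | Negz n => iter n.+1 (fun_inv S)
  end.

Definition coalgebra_antiaut (k : fieldType) (H : lmodType k) (A : hopf_ops H)
    (T : {linear H -> H}) : Prop :=
  [/\ bijective T,
      forall h, hcomul A (T h) = \sw[A]_(h1, h2 <- h) (T h2 ⊗ T h1)
    & forall h, hcounit A (T h) = hcounit A h].

Definition antipode_for (k : fieldType) (H : lmodType k) (A : hopf_ops H)
    (T : {linear H -> H}) : Prop :=
  forall h,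
    \sw[A]_(h1, h2 <- h) (h1 *_[A] T h2) = hcounit A h *: delta A /\
    \sw[A]_(h1, h2 <- h) (T h1 *_[A] h2) = hcounit A h *: delta A.

(* Coassociativity is stated in H ⊗ (H ⊗ H). Only products are required to be
   preserved by comul and counit: comul A (delta A) = delta A ⊗ delta A follows
   by applying comul to the antipode identity. *)
Record inverse_hopf_quasigroup (k : fieldType) (H : lmodType k) (m : int)
    (A : hopf_ops H) : Prop := InverseHopfQuasigroup {
  mul_deltal : forall h, delta A *_[A] h = h;
  mul_deltar : forall h, h *_[A] delta A = h;
  comul_coassoc : forall h,
    \sw[A]_(h1, x <- h) \sw[A]_(h2, h3 <- x) (h1 ⊗ (h2 ⊗ h3)) =
    \sw[A]_(x, h3 <- h) \sw[A]_(h1, h2 <- x) (h1 ⊗ (h2 ⊗ h3));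
  comul_counitl : forall h, \sw[A]_(h1, h2 <- h) (hcounit A h1 *: h2) = h;
  comul_counitr : forall h, \sw[A]_(h1, h2 <- h) (hcounit A h2 *: h1) = h;
  comul_mul : forall h g, hcomul A (h *_[A] g) =
    \sw[A]_(h1, h2 <- h) \sw[A]_(g1, g2 <- g) ((h1 *_[A] g1) ⊗ (h2 *_[A] g2));
  counit_mul : forall h g, hcounit A (h *_[A] g) = hcounit A h * hcounit A g;
  antip_antiaut : coalgebra_antiaut A (hantip A);
  antip_antipode : antipode_for A (hantip A);
  antip_unique : forall T : {linear H -> H},
    coalgebra_antiaut A T -> antipode_for A T -> T =1 hantip A;
  antip_inverse : forall h g,
    \sw[A]_(h1, h2 <- h)
      (zpow (hantip A) m (h2 *_[A] g) *_[A] zpow (hantip A) (m + 1) h1) =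
    hcounit A h *: zpow (hantip A) m g
}.

Definition antip_pow_aut (k : fieldType) (H : lmodType k) (A : hopf_ops H)
    (r : int) : Prop :=
  (forall h g, zpow (hantip A) r (h *_[A] g) =
     zpow (hantip A) r h *_[A] zpow (hantip A) r g) /\
  (forall h, hcomul A (zpow (hantip A) r h) =
     \sw[A]_(h1, h2 <- h) (zpow (hantip A) r h1 ⊗ zpow (hantip A) r h2)).

Section Bowtie.
Variables (k : fieldType) (H1 H2 : lmodType k).
Variables (A1 : hopf_ops H1) (A2 : hopf_ops H2).
Variables (phi : {linear (H2 ⊗ H1)%type -> H1}).
Variables (psi : {linear (H2 ⊗ H1)%type -> H2}).

Definition bowtie_mul (t : (H1 ⊗ H2) ⊗ (H1 ⊗ H2)) : H1 ⊗ H2 :=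
  \tsum_(x, y <- t) \tsum_(h, h' <- x) \tsum_(g, g' <- y)
    \sw[A2]_(h'1, h'2 <- h') \sw[A1]_(g1, g2 <- g)
      ((h *_[A1] phi (h'1 ⊗ g1)) ⊗ (psi (h'2 ⊗ g2) *_[A2] g')).

Lemma bowtie_mul_linear : linear bowtie_mul.
Proof. rewrite /bowtie_mul; solve_linear. Qed.

HB.instance Definition _ := GRing.isLinear.Build k _ _ _ _ bowtie_mul_linear.

Definition bowtie_unit (a : k^o) : H1 ⊗ H2 := (a : k) *: (delta A1 ⊗ delta A2).

Lemma bowtie_unit_linear : linear bowtie_unit.
Proof. by move=> a b c; rewrite /bowtie_unit scalerDl scalerA. Qed.

HB.instance Definition _ := GRing.isLinear.Build k _ _ _ _ bowtie_unit_linear.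

Definition bowtie_comul (t : H1 ⊗ H2) : (H1 ⊗ H2) ⊗ (H1 ⊗ H2) :=
  \tsum_(h, h' <- t) \sw[A1]_(h1, h2 <- h) \sw[A2]_(h'1, h'2 <- h')
    ((h1 ⊗ h'1) ⊗ (h2 ⊗ h'2)).

Lemma bowtie_comul_linear : linear bowtie_comul.
Proof. rewrite /bowtie_comul; solve_linear. Qed.

HB.instance Definition _ := GRing.isLinear.Build k _ _ _ _ bowtie_comul_linear.

Definition bowtie_counit (t : H1 ⊗ H2) : k^o :=
  \tsum_(h, h' <- t) (hcounit A1 h * hcounit A2 h').

Lemma bowtie_counit_linear : linear bowtie_counit.
Proof.
apply: linear_tsum_arg; last exact: linear_var.
  by move=> v a x y; rewrite linearP mulrDl -scalerAl.
by move=> u a x y; rewrite linearP mulrDr -scalerAr.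
Qed.

HB.instance Definition _ := GRing.isLinear.Build k _ _ _ _ bowtie_counit_linear.

Definition bowtie_antip (t : H1 ⊗ H2) : H1 ⊗ H2 :=
  \tsum_(h, h' <- t)
    bowtie_mul ((delta A1 ⊗ hantip A2 h') ⊗ (hantip A1 h ⊗ delta A2)).

Lemma bowtie_antip_linear : linear bowtie_antip.
Proof.
apply: linear_tsum_arg; last exact: linear_var.
  by move=> h'; apply: (linear_app bowtie_mul); solve_linear.
by move=> h; apply: (linear_app bowtie_mul); solve_linear.
Qed.

HB.instance Definition _ := GRing.isLinear.Build k _ _ _ _ bowtie_antip_linear.

Definition bowtie : hopf_ops (H1 ⊗ H2)%type :=
  HopfOps bowtie_mul bowtie_unit bowtie_comul bowtie_counit bowtie_antip.

Lemma bowtie_mulE h h' g g' :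
  (h ⊗ h') *_[bowtie] (g ⊗ g') =
  \sw[A2]_(h'1, h'2 <- h') \sw[A1]_(g1, g2 <- g)
    ((h *_[A1] phi (h'1 ⊗ g1)) ⊗ (psi (h'2 ⊗ g2) *_[A2] g')).
Proof.
rewrite /= /bowtie_mul tsumE; [|solve_linear..].
rewrite tsumE; [|solve_linear..].
by rewrite tsumE; [|solve_linear..].
Qed.

Lemma bowtie_antipE h h' :
  hantip bowtie (h ⊗ h') =
  (delta A1 ⊗ hantip A2 h') *_[bowtie] (hantip A1 h ⊗ delta A2).
Proof.
rewrite /= /bowtie_antip tsumE // => x.
  by apply: (linear_app bowtie_mul); solve_linear.
by apply: (linear_app bowtie_mul); solve_linear.
Qed.

End Bowtie.

Arguments bowtie {k H1 H2} A1 A2 phi psi.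

(* Main.v *)
From HB Require Import structures.
Require Import Defs.
From mathcomp Require Import all_boot all_order all_algebra.

Set Implicit Arguments.
Unset Strict Implicit.
Unset Printing Implicit Defensive.

Import GRing.Theory.
Local Open Scope ring_scope.

(* Write Phi (h' ⊗ h) = phi h'1 h1 ⊗ psi h'2 h2 for the product of h' and h in
   the bowtie (called [exch] below), so that the antipode is
   S (h ⊗ h') = Phi (S2 h' ⊗ S1 h). By (10), Phi is a coalgebra map, and by (4)
   and (8) its right convolution inverse is h' ⊗ h |-> S1 h ⊗ S2 h'.
   A pair of maps T, T' with T (x2 y) T' (x1) = eps x T y makes right
   convolution inverses of coalgebra maps unique: f * g = eps forces T g = T' f.
   Applied to the identity this gives the uniqueness of the antipode; applied to
   Phi, it gives S (Phi (h' ⊗ h)) = S1 h ⊗ S2 h', hence S^m = S1^m ⊗ S2^m for m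
   even and S^m (h ⊗ h') = Phi (S2^m h' ⊗ S1^m h) for m odd. The stated
   conditions are then the m-inverse identity on suitable elements.
   Conversely, for m odd, (3), (7) and the conditions give the m-inverse identity
   for T = Phi (S2^m ⊗ S1^m) and T' = S1^(m+1) ⊗ S2^(m+1) before T is known
   to be S^m. The uniqueness principle then shows first T S = T', so that Phi and
   S are bijective, then S Phi = S1 ⊗ S2 up to the flip, and finally
   T = S^m and T' = S^(m+1). *)

(** * Sweedler calculus *)

Section SweedlerCalculus.
Variable k : fieldType.
Implicit Types U V W Z H : lmodType k.

Lemma eq_tsum U V W (f g : U -> V -> W) t :
  (forall u v, f u v = g u v) -> tsum f t = tsum g t.
Proof. by move=> fg; apply: eq_bigr => p _. Qed.

Lemma linear_tsumE U V W Z (L : {linear W -> Z}) (f : U -> V -> W) t :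
  L (tsum f t) = tsum (fun u v => L (f u v)) t :> Z.
Proof. exact: linear_sum. Qed.

Lemma linear_scaleE W Z (L : {linear W -> Z}) (a : k) w :
  L (a *: w) = a *: (L w : Z) :> Z.
Proof. exact: linearZ. Qed.

Lemma scaler_tsum U V W (a : k) (f : U -> V -> W) t :
  tsum (fun u v => a *: f u v) t = a *: tsum f t.
Proof. by rewrite /tsum scaler_sumr. Qed.

Lemma tensl_tsum U V W Z (f : U -> V -> W) t (z : Z) :
  tsum f t ⊗ z = tsum (fun u v => f u v ⊗ z) t.
Proof.
pose L : {linear W -> (W ⊗ Z)%type} :=
  HB.pack (fun w : W => w ⊗ z) (GRing.isLinear.Build k _ _ _ _ (linear_tensl z)).
exact: (linear_tsumE L).
Qed.

Lemma tensr_tsum U V W Z (f : U -> V -> W) t (z : Z) :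
  z ⊗ tsum f t = tsum (fun u v => z ⊗ f u v) t.
Proof.
pose L : {linear W -> (Z ⊗ W)%type} :=
  HB.pack (fun w : W => z ⊗ w) (GRing.isLinear.Build k _ _ _ _ (linear_tensr z)).
exact: (linear_tsumE L).
Qed.

Lemma tensZl U V a (u : U) (v : V) : (a *: u) ⊗ v = a *: (u ⊗ v).
Proof. exact: (raw_linearZ a u (linear_tensl v)). Qed.

Lemma tensZr U V a (u : U) (v : V) : u ⊗ (a *: v) = a *: (u ⊗ v).
Proof. exact: (raw_linearZ a v (linear_tensr u)). Qed.

Lemma exchange_tsum U V U' V' W (f : U -> V -> U' -> V' -> W) s t :
  tsum (fun u v => tsum (fun u' v' => f u v u' v') s) t =
  tsum (fun u' v' => tsum (fun u v => f u v u' v') t) s.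
Proof. exact: exchange_big. Qed.

Lemma tsum_tsum U V U' V' W (f : U -> V -> W) (g : U' -> V' -> (U ⊗ V)%type) t :
  (forall v, linear (f^~ v)) -> (forall u, linear (f u)) ->
  tsum f (tsum g t) = tsum (fun u' v' => tsum f (g u' v')) t.
Proof.
move=> linl linr.
pose L : {linear (U ⊗ V)%type -> W} :=
  HB.pack (tsum f) (GRing.isLinear.Build k _ _ _ _ (linear_tsum linl linr)).
exact: (linear_tsumE L).
Qed.

Lemma tsumZ U V W (f : U -> V -> W) a t :
  (forall v, linear (f^~ v)) -> (forall u, linear (f u)) ->
  tsum f (a *: t) = a *: tsum f t.
Proof. by move=> linl linr; apply: raw_linearZ; apply: linear_tsum. Qed.

Lemma linear_scalel Z W (g : Z -> k^o) (w : W) :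
  linear g -> linear (fun z => (g z : k) *: w).
Proof. by move=> ling a x y; rewrite ling scalerDl scalerA. Qed.

Lemma linear_scaler Z W (a : k) (g : Z -> W) :
  linear g -> linear (fun z => a *: g z).
Proof.
by move=> ling b x y; rewrite ling scalerDr !scalerA mulrC.
Qed.

Lemma linear_mull Z (g : Z -> k^o) (b : k) :
  linear g -> linear (fun z => (g z * b : k^o)).
Proof. by move=> ling a x y; rewrite ling mulrDl -scalerAl. Qed.

Lemma linear_mulr Z (g : Z -> k^o) (b : k) :
  linear g -> linear (fun z => (b * g z : k^o)).
Proof. by move=> ling a x y; rewrite ling mulrDr; congr (_ + _); apply: mulrCA. Qed.

End SweedlerCalculus.

(* Unification otherwise unfolds these down to the quotient of lists. *)
Opaque tens tsum.

Ltac lin :=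
  intros; cbv beta;
  let K := match goal with K : fieldType |- _ => K end in
  lazymatch goal with
  | |- GRing.linear_for _ (fun z => z) => exact: linear_var
  | |- GRing.linear_for _ (fun z => tsum (@?f z) (@?g z)) =>
      match f with
      | (fun _ => ?f0) => apply: (@linear_tsum_arg K _ _ _ _ f0 g)
      | _ => match g with
             | (fun _ => ?t) => apply: (@linear_tsum_body K _ _ _ _ f t)
             end
      end; lin
  | |- GRing.linear_for _ (fun z => tens (@?f z) (@?g z)) =>
      match f with
      | (fun _ => ?u) => apply: (@linear_tens_argr K _ _ _ u g)
      | _ => match g with
             | (fun _ => ?v) => apply: (@linear_tens_argl K _ _ _ f v)
             end
      end; lin
  | |- GRing.linear_for _ (fun z => GRing.scale (@?f z) (@?g z)) =>
      match f with
      | (fun _ => ?a) => apply: (@linear_scaler K _ _ a g)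
      | _ => match g with
             | (fun _ => ?v) => apply: (@linear_scalel K _ _ f v)
             end
      end; lin
  | |- GRing.linear_for _ (fun z => GRing.mul (@?f z) (@?g z)) =>
      match f with
      | (fun _ => ?a) => apply: (@linear_mulr K _ g a)
      | _ => match g with
             | (fun _ => ?v) => apply: (@linear_mull K _ f v)
             end
      end; lin
  | |- GRing.linear_for _ (fun z => GRing.Linear.sort ?F (@?g z)) =>
      apply: (@linear_app K _ _ _ F g); lin
  | |- GRing.linear_for _ (GRing.scale ?a) =>
      exact: (@linear_scaler K _ _ a (fun z => z) (@linear_var K _))
  | |- GRing.linear_for _ id => exact: (@linear_var K _)
  | |- GRing.linear_for _ (GRing.Linear.sort ?F) => exact: (linearP F)
  end.

(** * Coassociativity and counit as identities of iterated sums *)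

Record coalgebra (k : fieldType) (H : lmodType k)
    (D : {linear H -> (H ⊗ H)%type}) (e : {linear H -> k^o}) : Prop := Coalgebra {
  coassoc : forall h,
    tsum (fun h1 x => tsum (fun h2 h3 => h1 ⊗ (h2 ⊗ h3)) (D x)) (D h) =
    tsum (fun x h3 => tsum (fun h1 h2 => h1 ⊗ (h2 ⊗ h3)) (D x)) (D h);
  counitl : forall h, tsum (fun h1 h2 => (e h1 : k) *: h2) (D h) = h;
  counitr : forall h, tsum (fun h1 h2 => (e h2 : k) *: h1) (D h) = h
}.

Section Coalgebra.
Variables (k : fieldType) (H : lmodType k).
Variables (D : {linear H -> (H ⊗ H)%type}) (e : {linear H -> k^o}).
Hypothesis coH : coalgebra D e.
Variable W : lmodType k.

(** A trilinear [F] induces a linear map on [H ⊗ (H ⊗ H)]; applying it to [coassoc] moves the inner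
    coproduct from the left leg to the right one. The body [f] is tied to [F] by an equation, so the
    sum over [D u] need not stand outermost in [f]. *)
Lemma tsum_assoc (f : H -> H -> W) (F : H -> H -> H -> W) h :
  (forall u v, f u v = tsum (fun a b => F a b v) (D u)) ->
  (forall b c, linear (fun a => F a b c)) ->
  (forall a c, linear (fun b => F a b c)) ->
  (forall a b, linear (fun c => F a b c)) ->
  tsum f (D h) = tsum (fun a x => tsum (fun b c => F a b c) (D x)) (D h).
Proof.
move=> fF la lb lc; rewrite (eq_tsum _ fF).
pose G (y : (H ⊗ (H ⊗ H))%type) := tsum (fun a z => tsum (fun b c => F a b c) z) y.
have linG1 (z : (H ⊗ H)%type) : linear (fun a => tsum (fun b c => F a b c) z).
  exact: linear_tsum_body.
have linG2 a : linear (fun z => tsum (fun b c => F a b c) z).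
  exact: linear_tsum.
have := congr1 G (coassoc coH h).
rewrite /G !tsum_tsum // => E; apply: etrans (etrans (esym E) _).
  apply: eq_tsum => u v; rewrite tsum_tsum //.
  by apply: eq_tsum => a b; rewrite !tsumE // => *; lin.
apply: eq_tsum => u v; rewrite tsum_tsum //.
by rewrite [in RHS](tensor_sum (D v)) [in RHS]tsum_tsum //;
   apply: eq_tsum => a b; rewrite !tsumE.
Qed.

(** Bilinearity turns [G (e u) v] into [G 1 (e u *: v)], and the counit axiom sums this to [G 1 h].
    Abstracting [e u] as [a] lets unification find [G], and makes it fail when [u] occurs
    elsewhere. *)
Lemma tsum_counitl (f : H -> H -> W) (G : k^o -> H -> W) h :
  (forall u v a, a = e u -> f u v = G a v) ->
  (forall v, linear (G^~ v)) -> (forall a, linear (G a)) ->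
  tsum f (D h) = G 1 h.
Proof.
move=> fG l1 l2; rewrite -[in RHS](counitl coH h).
pose L : {linear H -> W} :=
  HB.pack (G 1) (GRing.isLinear.Build k _ _ _ _ (l2 1)).
rewrite -[G 1]/(L : H -> W) linear_tsumE; apply: eq_tsum => u v.
rewrite (fG u v (e u)) // linearZ /=.
rewrite -(raw_linearZ _ _ (l1 v)); congr G; exact: (esym (mulr1 _)).
Qed.

Lemma tsum_counitr (f : H -> H -> W) (G : k^o -> H -> W) h :
  (forall u v a, a = e v -> f u v = G a u) ->
  (forall v, linear (G^~ v)) -> (forall a, linear (G a)) ->
  tsum f (D h) = G 1 h.
Proof.
move=> fG l1 l2; rewrite -[in RHS](counitr coH h).
pose L : {linear H -> W} :=
  HB.pack (G 1) (GRing.isLinear.Build k _ _ _ _ (l2 1)).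
rewrite -[G 1]/(L : H -> W) linear_tsumE; apply: eq_tsum => u v.
rewrite (fG u v (e v)) // linearZ /=.
rewrite -(raw_linearZ _ _ (l1 u)); congr G; exact: (esym (mulr1 _)).
Qed.

End Coalgebra.

Section Congruence.
Variable k : fieldType.
Implicit Types U V W : lmodType k.

Lemma congr_scalel V (a a' : k) (v : V) : a = a' -> a *: v = a' *: v.
Proof. by move->. Qed.

Lemma congr_scaler V (a : k) (v v' : V) : v = v' -> a *: v = a *: v'.
Proof. by move->. Qed.

End Congruence.

(* Rewriting rules for the coproduct, the counit, ... of structured elements; the
   hook is rebound whenever new rules become available. *)
Ltac sw_rules := fail.

(* Moves the sum over the coproduct of [u] to the front. *)
Ltac pull u :=
  cbv beta;
  lazymatch goal with
  | |- tsum _ (GRing.Linear.sort _ u) = _ => reflexivity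
  | |- tsum _ _ = _ =>
      eapply eq_trans; [apply: eq_tsum; intros; pull u | apply: exchange_tsum]
  end.

Ltac nf_scalar := rewrite ?mul1r ?mulr1; reflexivity.

Ltac nf_scale :=
  lazymatch goal with
  | |- _ *: (_ *: _) = _ =>
      eapply eq_trans; [apply: scalerA|];
      eapply eq_trans; [eapply congr_scalel; nf_scalar|];
      nf_scale
  | |- _ => rewrite ?scale1r; reflexivity
  end.

Ltac nf_clean :=
  cbv beta;
  lazymatch goal with
  | |- _ *: _ = _ =>
      eapply eq_trans; [eapply congr_scalel; nf_scalar| nf_scale]
  | |- GRing.mul _ _ = _ => nf_scalar
  | |- _ => reflexivity
  end.

(* Brings one sum over a coproduct into right-comb form, its body being already
   normalized: eliminates counits, pulls scalars out and applies
   coassociativity. *)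
Ltac nf_post :=
  cbv beta;
  lazymatch goal with
  | |- tsum _ (GRing.Linear.sort ?D ?x) = _ =>
      lazymatch goal with
      | co : coalgebra D ?e |- _ =>
        first
        [ eapply eq_trans;
          [eapply (tsum_counitl co);
            [let E := fresh in intros ? ? ? E; rewrite -E; reflexivity
            |lin|lin]
          | nf_clean ]
        | eapply eq_trans;
          [eapply (tsum_counitr co);
            [let E := fresh in intros ? ? ? E; rewrite -E; reflexivity
            |lin|lin]
          | nf_clean ]
        | eapply eq_trans; [apply: scaler_tsum|];
          eapply eq_trans; [eapply congr_scaler; nf_post| nf_scale]
        | eapply eq_trans;
          [eapply (tsum_assoc co);
            [let u := fresh "u" in let v := fresh "v" in
             intros u v; eapply eq_trans; [pull u | reflexivity]
            |lin|lin|lin]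
          | eapply eq_trans; [apply: eq_tsum; intros; nf_post | nf_post]]
        | reflexivity ]
      end
  | |- _ => reflexivity
  end.

(* Proves [E = ?R] where [?R] is instantiated with the Sweedler normal form of
   [E]: scalars and sums in front, the iterated coproducts as right combs. *)
Ltac nf :=
  cbv beta;
  lazymatch goal with
  | |- @tsum ?K ?U ?V ?W ?f _ = _ =>
      eapply eq_trans; [eapply (f_equal (@tsum K U V W f)); nf | nf_tsum]
  | |- @tens ?K ?U ?V _ _ = _ =>
      eapply eq_trans; [eapply (f_equal2 (@tens K U V)); nf | nf_tens]
  | |- @GRing.scale ?R ?V _ _ = _ =>
      eapply eq_trans; [eapply (f_equal2 (@GRing.scale R V)); nf | nf_scale]
  | |- @GRing.mul ?R _ _ = _ =>
      eapply eq_trans; [eapply (f_equal2 (@GRing.mul R)); nf | nf_scalar]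
  | |- @GRing.Linear.sort ?R ?U ?V ?s ?L _ = _ =>
      eapply eq_trans;
      [eapply (f_equal (@GRing.Linear.sort R U V s L)); nf | nf_app]
  | |- _ => reflexivity
  end
with nf_tens :=
  cbv beta;
  lazymatch goal with
  | |- tsum _ _ ⊗ _ = _ =>
      eapply eq_trans; [apply: tensl_tsum | nf_under]
  | |- _ ⊗ tsum _ _ = _ =>
      eapply eq_trans; [apply: tensr_tsum | nf_under]
  | |- (_ *: _) ⊗ _ = _ =>
      eapply eq_trans; [apply: tensZl |];
      eapply eq_trans; [eapply congr_scaler; nf_tens |]; nf_scale
  | |- _ ⊗ (_ *: _) = _ =>
      eapply eq_trans; [apply: tensZr |];
      eapply eq_trans; [eapply congr_scaler; nf_tens |]; nf_scale
  | |- _ => reflexivity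
  end
with nf_under :=
  eapply eq_trans; [apply: eq_tsum; intros; nf | nf_post]
with nf_app :=
  cbv beta;
  lazymatch goal with
  | |- GRing.Linear.sort ?L (tsum _ _) = _ =>
      eapply eq_trans; [eapply (linear_tsumE L) | nf_under]
  | |- GRing.Linear.sort ?L (_ *: _) = _ =>
      eapply eq_trans; [eapply (linear_scaleE L) |]; cbv beta;
      eapply eq_trans; [eapply congr_scaler; nf_app |]; nf_scale
  | |- _ => tryif sw_rules then nf else reflexivity
  end
with nf_tsum :=
  cbv beta;
  lazymatch goal with
  | |- tsum _ (_ ⊗ _) = _ =>
      eapply eq_trans; [apply: tsumE; lin | nf]
  | |- tsum _ (tsum _ _) = _ =>
      eapply eq_trans; [apply: tsum_tsum; lin | nf_under]
  | |- tsum _ (_ *: _) = _ =>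
      eapply eq_trans; [apply: tsumZ; lin |];
      eapply eq_trans; [eapply congr_scaler; nf_tsum |]; nf_scale
  | |- _ => nf_under
  end.

(* Normal forms are only unique up to the order of the sums. *)
Ltac sw_match :=
  cbv beta;
  lazymatch goal with
  | |- _ = tsum _ (GRing.Linear.sort _ ?x) =>
      eapply eq_trans; [pull x | apply: eq_tsum; intros; sw_match]
  | |- ?a *: _ = ?a *: _ => eapply congr_scaler; sw_match
  | |- _ => reflexivity
  end.

Ltac norm_both :=
  eapply eq_trans; [nf | apply: esym; eapply eq_trans; [nf | apply: esym]].
Ltac sweedler := norm_both; sw_match.

Ltac sw_rw tac :=
  cbv beta; first [tac; reflexivity | apply: eq_tsum; intros; sw_rw tac].
(* Replaces the left-hand side by [e], which has the same normal form, and
   rewrites with [tac] below the sums of [e]. *)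
Ltac sw_step e tac :=
  transitivity e; [sweedler | eapply eq_trans; [sw_rw tac |]; cbv beta].

Lemma tensor_ext (k : fieldType) (U V W : lmodType k) (f g : (U ⊗ V)%type -> W) :
  linear f -> linear g -> (forall u v, f (u ⊗ v) = g (u ⊗ v)) -> f =1 g.
Proof.
move=> lf lg fg t.
pose F : {linear (U ⊗ V)%type -> W} := HB.pack f (GRing.isLinear.Build k _ _ _ _ lf).
pose G : {linear (U ⊗ V)%type -> W} := HB.pack g (GRing.isLinear.Build k _ _ _ _ lg).
rewrite -[f]/(F : _ -> _) -[g]/(G : _ -> _) [t]tensor_sum !linear_tsumE.
by apply: eq_tsum => u v; apply: fg.
Qed.

(** * Coalgebras and convolution *)

Section TensorCoalgebra.
Variables (k : fieldType) (H1 H2 : lmodType k).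
Variables (A1 : hopf_ops H1) (A2 : hopf_ops H2).

Definition tcomul : {linear (H1 ⊗ H2)%type -> ((H1 ⊗ H2) ⊗ (H1 ⊗ H2))%type} :=
  bowtie_comul A1 A2.
Definition tcounit : {linear (H1 ⊗ H2)%type -> k^o} := bowtie_counit A1 A2.

Lemma tcomulE h h' : tcomul (h ⊗ h') =
  \sw[A1]_(h1, h2 <- h) \sw[A2]_(h'1, h'2 <- h') ((h1 ⊗ h'1) ⊗ (h2 ⊗ h'2)).
Proof. by rewrite /= /bowtie_comul tsumE //; lin. Qed.

Lemma tcounitE h h' : tcounit (h ⊗ h') = hcounit A1 h * hcounit A2 h'.
Proof. by rewrite /= /bowtie_counit tsumE //; lin. Qed.

Ltac sw_rules ::= first [rewrite tcomulE | rewrite tcounitE].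

Hypothesis co1 : coalgebra (hcomul A1) (hcounit A1).
Hypothesis co2 : coalgebra (hcomul A2) (hcounit A2).

Lemma coalgebra_tensor : coalgebra tcomul tcounit.
Proof. by split; apply: tensor_ext; try lin; move=> h h'; sweedler. Qed.

End TensorCoalgebra.

Section InverseHopfQuasigroup.
Variables (k : fieldType) (H : lmodType k) (m : int) (A : hopf_ops H).
Hypothesis HQ : inverse_hopf_quasigroup m A.

Lemma hq_coalgebra : coalgebra (hcomul A) (hcounit A).
Proof.
split; [exact: comul_coassoc HQ|exact: comul_counitl HQ|exact: comul_counitr HQ].
Qed.

(** Multiplicativity gives eps(h1) eps(delta) = eps(h1 delta) = eps(h1). The result is phrased as an
    action because [hcounit A (delta A) = 1] fails on the zero space. *)
Lemma counit_deltaZ (h : H) : (hcounit A (delta A) : k) *: h = h.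
Proof.
rewrite -[in RHS](comul_counitl HQ h) -[in LHS](comul_counitl HQ h).
rewrite -scaler_tsum; apply: eq_tsum => h1 h2.
by rewrite scalerA mulrC -(counit_mul HQ) (mul_deltar HQ).
Qed.

Let co := hq_coalgebra.
Let S_comul : forall h, hcomul A (hantip A h) =
  \sw[A]_(h1, h2 <- h) (hantip A h2 ⊗ hantip A h1).
Proof. by case: (antip_antiaut HQ). Qed.

Ltac sw_rules ::= first [rewrite (comul_mul HQ) | rewrite S_comul
 | rewrite (mul_deltal HQ) | rewrite (mul_deltar HQ)].

(** Write d for [delta A]. Then d is the sum of d1 S(d2), whose coproduct is d1 S(d4) ⊗ d2 S(d3)
    because S reverses coproducts. The antipode identity collapses the inner pair, then the outer
    one. *)
Lemma comul_delta : hcomul A (delta A) = delta A ⊗ delta A.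
Proof.
rewrite -[in LHS](counit_deltaZ (delta A)) -(antip_antipode HQ _).1.
have coA := co.
sw_step (\sw[A]_(u, v, w <- delta A)
  ((u *_[A] hantip A w) ⊗ \sw[A]_(p, q <- v) (p *_[A] hantip A q)))
  ltac:(rewrite (antip_antipode HQ _).1).
sw_step ((\sw[A]_(u, w <- delta A) (u *_[A] hantip A w)) ⊗ delta A)
  ltac:(rewrite (antip_antipode HQ _).1 counit_deltaZ).
by [].
Qed.

End InverseHopfQuasigroup.

(** * Uniqueness of right convolution inverses *)

Section Convolution.
Variables (k : fieldType) (H : lmodType k) (A : hopf_ops H).
Hypothesis mul1 : forall h, delta A *_[A] h = h.
Variables T T' : {linear H -> H}.
Hypothesis T_delta : T (delta A) = delta A.
Hypothesis T_inverse : forall h g,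
  \sw[A]_(h1, h2 <- h) (T (h2 *_[A] g) *_[A] T' h1) = hcounit A h *: T g.
Variables (C : lmodType k) (D : {linear C -> (C ⊗ C)%type}) (e : {linear C -> k^o}).
Hypothesis coC : coalgebra D e.
Variables f g : {linear C -> H}.
Hypothesis f_comul : forall c, hcomul A (f c) = tsum (fun a b => f a ⊗ f b) (D c).
Hypothesis f_counit : forall c, hcounit A (f c) = e c.
Hypothesis fg : forall c, tsum (fun a b => f a *_[A] g b) (D c) = e c *: delta A.

Ltac sw_rules ::= first [rewrite f_comul | rewrite f_counit | rewrite T_delta
   | rewrite mul1].

(** Since [f] is a coalgebra map, T(g(c)) = eps(f(c1)) T(g(c2)) = T(f(c2) g(c3)) T'(f(c1)) by the
    inverse property. Then f(c2) g(c3) collapses to eps(c2) delta, which leaves T'(f(c)). *)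
Lemma right_convolution_inverse c : T (g c) = T' (f c).
Proof.
transitivity (tsum (fun a b => (hcounit A (f a) : k) *: T (g b)) (D c)); first by sweedler.
eapply eq_trans; first by sw_rw ltac:(rewrite -T_inverse).
sw_step (tsum (fun a x => T (tsum (fun u v => f u *_[A] g v) (D x)) *_[A] T' (f a)) (D c))
  ltac:(rewrite fg).
by sweedler.
Qed.

End Convolution.

Section Antipode.
Variables (k : fieldType) (H : lmodType k) (A : hopf_ops H).
Hypothesis coA : coalgebra (hcomul A) (hcounit A).
Hypothesis mul1 : forall h, delta A *_[A] h = h.
Variables T T' : {linear H -> H}.
Hypothesis T_delta : T (delta A) = delta A.
Hypothesis T_inverse : forall h g,
  \sw[A]_(h1, h2 <- h) (T (h2 *_[A] g) *_[A] T' h1) = hcounit A h *: T g.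

(** This is the convolution principle with [f] the identity. When [T] is injective, it leaves at
    most one right antipode. *)
Lemma antipode_inverse (g : {linear H -> H}) :
  (forall h, \sw[A]_(h1, h2 <- h) (h1 *_[A] g h2) = hcounit A h *: delta A) ->
  forall h, T (g h) = T' h.
Proof.
move=> gP h; pose f : {linear H -> H} := idfun.
have f_comul c : hcomul A (f c) = \sw[A]_(a, b <- c) (f a ⊗ f b) by exact: tensor_sum.
exact: (right_convolution_inverse mul1 T_delta T_inverse coA f_comul (fun c => erefl) gP).
Qed.

End Antipode.

(** * Tensor products of linear maps, with and without a flip *)

Section TensorMaps.
Variables (k : fieldType) (U V U' V' : lmodType k).
Variables (P : {linear U -> U'}) (Q : {linear V -> V'}).

Definition tmap_fun (t : U ⊗ V) : U' ⊗ V' := \tsum_(u, v <- t) (P u ⊗ Q v).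
Definition tswap_fun (t : U ⊗ V) : V' ⊗ U' := \tsum_(u, v <- t) (Q v ⊗ P u).

Lemma tmap_linear : linear tmap_fun.
Proof. by rewrite /tmap_fun; lin. Qed.

Lemma tswap_linear : linear tswap_fun.
Proof. by rewrite /tswap_fun; lin. Qed.

HB.instance Definition _ := GRing.isLinear.Build k _ _ _ _ tmap_linear.
HB.instance Definition _ := GRing.isLinear.Build k _ _ _ _ tswap_linear.

Definition tmap : {linear (U ⊗ V)%type -> (U' ⊗ V')%type} := tmap_fun.
Definition tswap : {linear (U ⊗ V)%type -> (V' ⊗ U')%type} := tswap_fun.

Lemma tmapE u v : tmap (u ⊗ v) = P u ⊗ Q v.
Proof. by rewrite /= /tmap_fun tsumE //; lin. Qed.

Lemma tswapE u v : tswap (u ⊗ v) = Q v ⊗ P u.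
Proof. by rewrite /= /tswap_fun tsumE //; lin. Qed.

End TensorMaps.

(** * Integer powers of the antipode *)

Section ZPow.
Variables (k : fieldType) (H : lmodType k) (S : {linear H -> H}).
Hypothesis bijS : bijective S.

Let SK : cancel S (fun_inv S). Proof. by case: (fun_invK bijS). Qed.
Let VK : cancel (fun_inv S) S. Proof. by case: (fun_invK bijS). Qed.

Lemma zpowS m h : zpow S (m + 1) h = S (zpow S m h).
Proof.
case: m => [n|[|n]]; first by rewrite -PoszD addn1.
  (* [Negz 0] is -1: a single [fun_inv], which [S] undoes. *)
  by have -> : Negz 0 + 1 = 0 by []; rewrite /= VK.
have -> : Negz n.+1 + 1 = Negz n.
  by rewrite !NegzE -[in LHS]addn1 PoszD opprD subrK.
by rewrite /= VK.
Qed.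

Lemma zpowB1 m h : zpow S (m - 1) h = fun_inv S (zpow S m h).
Proof. by rewrite -[in RHS](subrK 1 m) zpowS SK. Qed.

(** Injectivity of [S] lets the upward recursion determine the negative exponents too, so a closed
    form for the powers needs only one recursion. *)
Lemma zpow_unique (R : int -> H -> H) :
  (forall h, R 0 h = h) -> (forall m h, S (R m h) = R (m + 1) h) ->
  forall m h, zpow S m h = R m h.
Proof.
move=> R0 RS m h; elim/int_rec: m => [|n IH|n IH]; first by rewrite R0.
- by rewrite -addn1 PoszD zpowS IH RS.
- rewrite -addn1 PoszD opprD zpowB1 IH; apply: (can_inj SK).
  by rewrite VK RS subrK.
Qed.

Lemma zpowD m n h : zpow S (m + n) h = zpow S m (zpow S n h).
Proof.
elim/int_rec: m => [|i IH|i IH]; first by rewrite add0r.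
- by rewrite -addn1 PoszD addrAC !zpowS IH.
- by rewrite -addn1 PoszD opprD addrAC !zpowB1 IH.
Qed.

Lemma zpow_bij m : bijective (zpow S m).
Proof.
by exists (zpow S (- m)) => h; rewrite -zpowD (addNr, addrN).
Qed.

Lemma fun_inv_linear : linear (fun_inv S).
Proof. by move=> a x y; apply: (can_inj SK); rewrite linearP !VK. Qed.

Lemma zpow_linear m : linear (zpow S m).
Proof.
elim/int_rec: m => [|n IH|n IH] a x y //.
- by rewrite -addn1 PoszD !zpowS IH linearP.
- by rewrite -addn1 PoszD opprD !zpowB1 IH fun_inv_linear.
Qed.

Definition lzpow m : {linear H -> H} :=
  HB.pack (zpow S m) (GRing.isLinear.Build k _ _ _ _ (zpow_linear m)).

Lemma lzpowE m h : lzpow m h = zpow S m h.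
Proof. by []. Qed.

End ZPow.

Section TensorBij.
Variables (k : fieldType) (U V : lmodType k).
Variables (P : {linear U -> U}) (Q : {linear V -> V}).
Hypotheses (bijP : bijective P) (bijQ : bijective Q).

Let P' : {linear U -> U} := lzpow bijP (-1).
Let Q' : {linear V -> V} := lzpow bijQ (-1).
Let PK : cancel P P'. Proof. by case: (fun_invK bijP). Qed.
Let P'K : cancel P' P. Proof. by case: (fun_invK bijP). Qed.
Let QK : cancel Q Q'. Proof. by case: (fun_invK bijQ). Qed.
Let Q'K : cancel Q' Q. Proof. by case: (fun_invK bijQ). Qed.

Lemma tmap_bij : bijective (tmap P Q).
Proof.
by exists (tmap P' Q'); apply: tensor_ext; try lin; move=> u v;
  rewrite !tmapE ?PK ?QK ?P'K ?Q'K.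
Qed.

Lemma tswap_bij : bijective (tswap P Q).
Proof.
by exists (tswap Q' P'); apply: tensor_ext; try lin; move=> u v;
  rewrite !tswapE ?PK ?QK ?P'K ?Q'K.
Qed.

End TensorBij.

Opaque tmap tswap.

(** Below zero, adding one lowers the absolute value, but the parity still changes. *)
Lemma odd_absS (m : int) : odd `|(m + 1)%R|%N = ~~ odd `|m|%N.
Proof.
case: m => [n|[|n]] //; first by rewrite -PoszD addn1.
have -> : Negz n.+1 + 1 = Negz n.
  by rewrite !NegzE -[in LHS]addn1 PoszD opprD subrK.
by rewrite /= negbK.
Qed.

Lemma zpow_fixed (k : fieldType) (H : lmodType k) (S : {linear H -> H})
  (bijS : bijective S) m h : S h = h -> zpow S m h = h.
Proof.
have [SK VK] := fun_invK bijS => Sh.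
elim/int_rec: m => [|n IH|n IH] //.
- by rewrite -addn1 PoszD zpowS // IH.
- by rewrite -addn1 PoszD opprD zpowB1 // IH -[in LHS]Sh SK.
Qed.

Section AntipodePowers.
Variables (k : fieldType) (H : lmodType k) (A : hopf_ops H).
Local Notation S := (hantip A).

Section CoalgebraAntiaut.
Hypothesis S_antiaut : coalgebra_antiaut A S.

Let bijS : bijective S. Proof. by case: S_antiaut. Qed.
Let SK : cancel S (fun_inv S). Proof. by case: (fun_invK bijS). Qed.
Let VK : cancel (fun_inv S) S. Proof. by case: (fun_invK bijS). Qed.
Let V : {linear H -> H} := lzpow bijS (-1).

Lemma zpow_counit m h : hcounit A (zpow S m h) = hcounit A h.
Proof.
have [_ _ eS] := S_antiaut.
elim/int_rec: m => [|n IH|n IH] //.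
- by rewrite -addn1 PoszD zpowS // eS.
- by rewrite -addn1 PoszD opprD zpowB1 // -eS VK.
Qed.

(** Write [h] on the right as [S] of its preimage; the reversal by [S] and the one in the sum
    cancel. *)
Lemma comul_fun_inv h :
  hcomul A (fun_inv S h) = \sw[A]_(h1, h2 <- h) (V h2 ⊗ V h1).
Proof.
have [_ dS _] := S_antiaut.
rewrite -{2}[h]VK dS tsum_tsum; [|lin|lin].
rewrite [LHS]tensor_sum; apply: eq_tsum => u v.
by rewrite tsumE; [rewrite /= !SK|lin|lin].
Qed.

(** Each factor [S] or its inverse flips the two legs once, so the parity of the exponent decides
    their order. *)
Lemma zpow_comul m h : hcomul A (zpow S m h) =
  if odd `|m|%N then \sw[A]_(h1, h2 <- h) (zpow S m h2 ⊗ zpow S m h1)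
  else \sw[A]_(h1, h2 <- h) (zpow S m h1 ⊗ zpow S m h2).
Proof.
have [_ dS _] := S_antiaut.
(* One step serves both directions of the induction: [L] is [S] upwards and its inverse
   downwards. *)
have step (L : {linear H -> H}) n n' : odd `|n'|%N = ~~ odd `|n|%N ->
    (forall h, hcomul A (L h) = \sw[A]_(h1, h2 <- h) (L h2 ⊗ L h1)) ->
    (forall h, zpow S n' h = L (zpow S n h)) ->
    hcomul A (zpow S n h) =
     (if odd `|n|%N then \sw[A]_(h1, h2 <- h) (zpow S n h2 ⊗ zpow S n h1)
      else \sw[A]_(h1, h2 <- h) (zpow S n h1 ⊗ zpow S n h2)) ->
    hcomul A (zpow S n' h) =
     (if odd `|n'|%N then \sw[A]_(h1, h2 <- h) (zpow S n' h2 ⊗ zpow S n' h1)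
      else \sw[A]_(h1, h2 <- h) (zpow S n' h1 ⊗ zpow S n' h2)).
  move=> -> dL zL IH; rewrite zL dL IH; case: odd => /=;
    (rewrite tsum_tsum; [|lin|lin]); apply: eq_tsum => u v;
    by rewrite tsumE; [rewrite !zL|lin|lin].
elim/int_rec: m => [|n IH|n IH]; first exact: tensor_sum.
- apply: (step S n); [|exact: dS| |exact: IH].
    by rewrite -odd_absS -PoszD addn1.
  by move=> x; rewrite -addn1 PoszD zpowS.
- apply: (step V (- n%:Z)); [|exact: comul_fun_inv| |exact: IH].
    by rewrite !abszN /=.
  by move=> x; rewrite -addn1 PoszD opprD zpowB1.
Qed.

End CoalgebraAntiaut.

Lemma zpow_mul r q : bijective S ->
  (forall h g, zpow S r (h *_[A] g) = zpow S r h *_[A] zpow S r g) ->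
  forall h g, zpow S (q * r) (h *_[A] g) = zpow S (q * r) h *_[A] zpow S (q * r) g.
Proof.
move=> bijS mulS; elim/int_rec: q => [|n IH|n IH] h g; first by rewrite mul0r.
- by rewrite -addn1 PoszD mulrDl mul1r addrC !zpowD // IH mulS.
(* S^r raises the exponent -(n+1)r to -nr, where the induction hypothesis applies; S^r is injective,
   so comparing there suffices. *)
- have zpowr x : zpow S r (zpow S (- n.+1%:Z * r) x) = zpow S (- n%:Z * r) x.
    by rewrite -zpowD // -{1}[r]mul1r -mulrDl -addn1 PoszD opprD addrCA subrr addr0.
  apply: (bij_inj (zpow_bij bijS r)).
  by rewrite mulS !zpowr IH.
Qed.

(** Write n = qr + m. Since S^(qr) is multiplicative, applying it to the m-inverse identity gives
    the n-inverse identity. *)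
Lemma antip_inverse_mod m r n : inverse_hopf_quasigroup m A ->
  antip_pow_aut A r -> (n = m %[mod r])%Z -> forall h g,
    \sw[A]_(h1, h2 <- h) (zpow S n (h2 *_[A] g) *_[A] zpow S (n + 1) h1) =
    hcounit A h *: zpow S n g.
Proof.
move=> HQ [mulS _] /eqP; rewrite eqz_mod_dvd => /dvdzP[q nm] h g.
have bijS : bijective S by case: (antip_antiaut HQ).
have -> : n = q * r + m by rewrite -nm subrK.
have Sqr := zpow_mul q bijS mulS.
under eq_tsum => h1 h2 do rewrite -addrA !(zpowD bijS (q * r)) -Sqr -(lzpowE bijS (q * r)).
rewrite -linear_tsumE (antip_inverse HQ) linear_scaleE lzpowE zpowD //.
Qed.

End AntipodePowers.

(** * The bowtie product *)

Section Bowtie.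
Variables (k : fieldType) (H1 H2 : lmodType k).
Variables (A1 : hopf_ops H1) (A2 : hopf_ops H2) (m1 m2 : int).
Hypothesis HQ1 : inverse_hopf_quasigroup m1 A1.
Hypothesis HQ2 : inverse_hopf_quasigroup m2 A2.
Variables (phi : {linear (H2 ⊗ H1)%type -> H1}).
Variables (psi : {linear (H2 ⊗ H1)%type -> H2}).

Local Notation S1 := (hantip A1).
Local Notation S2 := (hantip A2).
Local Notation e1 := (hcounit A1).
Local Notation e2 := (hcounit A2).
Local Notation B := (bowtie A1 A2 phi psi).

Hypothesis S1_delta : S1 (delta A1) = delta A1.
Hypothesis S2_delta : S2 (delta A2) = delta A2.
Hypothesis phi_deltal : forall h, phi (delta A2 ⊗ h) = h.
Hypothesis phi_deltar : forall h', phi (h' ⊗ delta A1) = e2 h' *: delta A1.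
Hypothesis psi_deltal : forall h, psi (delta A2 ⊗ h) = e1 h *: delta A2.
Hypothesis psi_deltar : forall h', psi (h' ⊗ delta A1) = h'.
Hypothesis phi_S2VK : forall h h',
  \sw[A2]_(h'1, h'2 <- h') phi (h'1 ⊗ phi (S2 h'2 ⊗ h)) = e2 h' *: h.
Hypothesis psi_S1K : forall h h',
  \sw[A1]_(h1, h2 <- h) psi (psi (h' ⊗ S1 h1) ⊗ h2) = e1 h *: h'.
Hypothesis psi_S1VK : forall h h',
  \sw[A1]_(h1, h2 <- h) psi (psi (h' ⊗ h1) ⊗ S1 h2) = e1 h *: h'.
Hypothesis phi_comul : forall h h', hcomul A1 (phi (h' ⊗ h)) =
  \sw[A2]_(h'1, h'2 <- h') \sw[A1]_(h1, h2 <- h)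
    (phi (h'1 ⊗ h1) ⊗ phi (h'2 ⊗ h2)).
Hypothesis phi_counit : forall h h', e1 (phi (h' ⊗ h)) = e1 h * e2 h'.
Hypothesis psi_comul : forall h h', hcomul A2 (psi (h' ⊗ h)) =
  \sw[A2]_(h'1, h'2 <- h') \sw[A1]_(h1, h2 <- h)
    (psi (h'1 ⊗ h1) ⊗ psi (h'2 ⊗ h2)).
Hypothesis psi_counit : forall h h', e2 (psi (h' ⊗ h)) = e1 h * e2 h'.
Hypothesis phi_psiS : forall h h',
  \sw[A2]_(h'1, h'2 <- h') \sw[A1]_(h1, h2, h3 <- h)
    (phi (h'1 ⊗ S1 h2) *_[A1] phi (psi (h'2 ⊗ S1 h1) ⊗ h3)) =
  (e1 h * e2 h') *: delta A1.
Hypothesis phi_psiVS : forall h h',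
  \sw[A2]_(h'1, h'2 <- h') \sw[A1]_(h1, h2, h3 <- h)
    (phi (h'1 ⊗ h1) *_[A1] phi (psi (h'2 ⊗ h2) ⊗ S1 h3)) =
  (e1 h * e2 h') *: delta A1.
Hypothesis psi_phiVS : forall h h',
  \sw[A2]_(h'1, h'2, h'3 <- h') \sw[A1]_(h1, h2 <- h)
    (psi (h'1 ⊗ phi (S2 h'3 ⊗ h1)) *_[A2] psi (S2 h'2 ⊗ h2)) =
  (e1 h * e2 h') *: delta A2.
Hypothesis psi_phi_sym : forall h h',
  \sw[A2]_(h'1, h'2 <- h') \sw[A1]_(h1, h2 <- h)
    (psi (h'1 ⊗ h1) ⊗ phi (h'2 ⊗ h2)) =
  \sw[A2]_(h'1, h'2 <- h') \sw[A1]_(h1, h2 <- h)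
    (psi (h'2 ⊗ h2) ⊗ phi (h'1 ⊗ h1)).

Let co1 : coalgebra (hcomul A1) (hcounit A1) := hq_coalgebra HQ1.
Let co2 : coalgebra (hcomul A2) (hcounit A2) := hq_coalgebra HQ2.

Let S1_comul : forall h, hcomul A1 (S1 h) = \sw[A1]_(h1, h2 <- h) (S1 h2 ⊗ S1 h1).
Proof. by case: (antip_antiaut HQ1). Qed.
Let S2_comul : forall h, hcomul A2 (S2 h) = \sw[A2]_(h1, h2 <- h) (S2 h2 ⊗ S2 h1).
Proof. by case: (antip_antiaut HQ2). Qed.
Let S1_counit : forall h, e1 (S1 h) = e1 h.
Proof. by case: (antip_antiaut HQ1). Qed.
Let S2_counit : forall h, e2 (S2 h) = e2 h.
Proof. by case: (antip_antiaut HQ2). Qed.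

Ltac bowtie_rules := first
 [ rewrite (bowtie_mulE A1 A2 phi psi) | rewrite (tcomulE A1 A2) | rewrite (tcounitE A1 A2)
 | rewrite (tcomulE A2 A1) | rewrite (tcounitE A2 A1)
 | rewrite (mul_deltal HQ1) | rewrite (mul_deltar HQ1)
 | rewrite (mul_deltal HQ2) | rewrite (mul_deltar HQ2)
 | rewrite phi_deltal | rewrite phi_deltar | rewrite psi_deltal | rewrite psi_deltar
 | rewrite S1_delta | rewrite S2_delta
 | rewrite (comul_delta HQ1) | rewrite (comul_delta HQ2)
 | rewrite (comul_mul HQ1) | rewrite (comul_mul HQ2)
 | rewrite (counit_mul HQ1) | rewrite (counit_mul HQ2)
 | rewrite S1_comul | rewrite S2_comul | rewrite S1_counit | rewrite S2_counit
 | rewrite phi_comul | rewrite phi_counit | rewrite psi_comul | rewrite psi_counit ].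
Ltac sw_rules ::= bowtie_rules.

(** * Unit, coproduct and counit of the bowtie *)

Lemma delta_bowtie : delta B = delta A1 ⊗ delta A2.
Proof. exact: scale1r. Qed.

Lemma bowtie_unitl x : delta B *_[B] x = x.
Proof.
rewrite delta_bowtie; move: x; apply: tensor_ext; try lin.
move=> h h'; sweedler.
Qed.

Lemma bowtie_unitr x : x *_[B] delta B = x.
Proof.
rewrite delta_bowtie; move: x; apply: tensor_ext; try lin.
move=> h h'; sweedler.
Qed.

Let coB : coalgebra (tcomul A1 A2) (tcounit A1 A2) := coalgebra_tensor co1 co2.

(** After expansion the two sides differ only in which middle leg goes to [psi] and which to [phi].
    These legs are packed into one tensor, bound by [\tsum], so that [psi_phi_sym] can exchange
    them. *)
Lemma bowtie_comul_mul x y : hcomul B (x *_[B] y) =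
  \sw[B]_(x1, x2 <- x) \sw[B]_(y1, y2 <- y) ((x1 *_[B] y1) ⊗ (x2 *_[B] y2)).
Proof.
rewrite -[hcomul B]/(tcomul A1 A2).
move: x; apply: tensor_ext; [lin|lin|] => a a'.
move: y; apply: tensor_ext; [lin|lin|] => b b'.
sw_step (\sw[A1]_(a1, a2 <- a) \sw[A2]_(b'1, b'2 <- b')
  \sw[A2]_(s', x' <- a') \sw[A2]_(u', t' <- x')
  \sw[A1]_(s, x <- b) \sw[A1]_(u, t <- x)
  \tsum_(p, q <- \sw[A2]_(u'1, u'2 <- u') \sw[A1]_(u1, u2 <- u)
    (psi (u'2 ⊗ u2) ⊗ phi (u'1 ⊗ u1)))
  (((a1 *_[A1] phi (s' ⊗ s)) ⊗ (p *_[A2] b'1)) ⊗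
   ((a2 *_[A1] q) ⊗ (psi (t' ⊗ t) *_[A2] b'2)))) ltac:(rewrite -psi_phi_sym).
sweedler.
Qed.

Lemma bowtie_counit_mul x y : tcounit A1 A2 (x *_[B] y) =
  tcounit A1 A2 x * tcounit A1 A2 y :> k^o.
Proof.
move: x; apply: tensor_ext; [lin|lin|] => a a'.
move: y; apply: tensor_ext; [lin|lin|] => b b'.
by norm_both; rewrite -!mulrA; congr (_ * _); apply: mulrCA.
Qed.

(** * The exchange map and the antipode *)

Definition exchange_fun (t : H2 ⊗ H1) : H1 ⊗ H2 :=
  \tsum_(h', h <- t) ((delta A1 ⊗ h') *_[B] (h ⊗ delta A2)).

Lemma exchange_linear : linear exchange_fun.
Proof. rewrite /exchange_fun; lin. Qed.

HB.instance Definition _ := GRing.isLinear.Build k _ _ _ _ exchange_linear.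

Definition exch : {linear (H2 ⊗ H1)%type -> (H1 ⊗ H2)%type} := exchange_fun.

Lemma exchE h' h : exch (h' ⊗ h) =
  \sw[A2]_(h'1, h'2 <- h') \sw[A1]_(h1, h2 <- h) (phi (h'1 ⊗ h1) ⊗ psi (h'2 ⊗ h2)).
Proof.
by rewrite /= /exchange_fun tsumE; [sweedler|lin|lin].
Qed.

Lemma exch_mul h' h : (delta A1 ⊗ h') *_[B] (h ⊗ delta A2) = exch (h' ⊗ h).
Proof. by rewrite exchE; sweedler. Qed.

Lemma bowtie_antip_exch h h' : hantip B (h ⊗ h') = exch (S2 h' ⊗ S1 h).
Proof. by rewrite bowtie_antipE exch_mul. Qed.

Ltac exch_rules := first [ rewrite exchE | rewrite bowtie_antip_exch
  | rewrite tswapE | rewrite tmapE | bowtie_rules ].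
Ltac sw_rules ::= exch_rules.

Lemma exch_comul c : tcomul A1 A2 (exch c) =
  tsum (fun a b => exch a ⊗ exch b) (tcomul A2 A1 c).
Proof.
move: c; apply: tensor_ext; [lin|lin|] => a' a.
sw_step (\sw[A2]_(s', x' <- a') \sw[A2]_(u', t' <- x')
  \sw[A1]_(s, x <- a) \sw[A1]_(u, t <- x)
  \tsum_(p, q <- \sw[A2]_(u'1, u'2 <- u') \sw[A1]_(u1, u2 <- u)
    (psi (u'2 ⊗ u2) ⊗ phi (u'1 ⊗ u1)))
  ((phi (s' ⊗ s) ⊗ p) ⊗ (q ⊗ psi (t' ⊗ t)))) ltac:(rewrite -psi_phi_sym).
by sweedler.
Qed.

Lemma exch_counit c : tcounit A1 A2 (exch c) = tcounit A2 A1 c.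
Proof.
move: c; apply: tensor_ext; [lin|lin|] => a' a.
by norm_both; apply: mulrC.
Qed.

Ltac sw_rules ::= first [ rewrite bowtie_antip_exch | bowtie_rules ].

(** [exch] preserves coproducts, while [S1] and [S2] reverse them. The rules bound just above keep
    [exch] folded, so both sides normalize to sums of tensors of [exch] terms. *)
Lemma bowtie_antip_comul x : tcomul A1 A2 (hantip B x) =
  tsum (fun a b => hantip B b ⊗ hantip B a) (tcomul A1 A2 x).
Proof.
move: x; apply: tensor_ext; [lin|lin|] => h h'.
by rewrite bowtie_antip_exch exch_comul; sweedler.
Qed.

Ltac sw_rules ::= exch_rules.

Lemma bowtie_antip_counit x : tcounit A1 A2 (hantip B x) = tcounit A1 A2 x.
Proof.
move: x; apply: tensor_ext; [lin|lin|] => h h'.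
by rewrite bowtie_antip_exch exch_counit; norm_both; apply: mulrC.
Qed.

(** The [H2] legs collapse first, by [psi_phiVS]; then [phi_S2VK] removes the nested actions on
    [H1], leaving h1 S1(h2). *)
Lemma bowtie_antipr x : tsum (fun a b => a *_[B] hantip B b) (tcomul A1 A2 x) =
  (tcounit A1 A2 x : k) *: delta B.
Proof.
move: x; apply: tensor_ext; [lin|lin|] => h h'.
rewrite delta_bowtie.
sw_step (\sw[A1]_(a, x <- h) \sw[A2]_(a', y', b' <- h') \sw[A1]_(s, t <- S1 x)
  ((a *_[A1] phi (a' ⊗ phi (S2 b' ⊗ s))) ⊗
    \sw[A2]_(h'1, h'2, h'3 <- y') \sw[A1]_(h1, h2 <- t)
      (psi (h'1 ⊗ phi (S2 h'3 ⊗ h1)) *_[A2] psi (S2 h'2 ⊗ h2))))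
  ltac:(rewrite psi_phiVS).
sw_step (\sw[A1]_(a, x <- h) ((a *_[A1]
  \sw[A2]_(a', b' <- h') phi (a' ⊗ phi (S2 b' ⊗ S1 x))) ⊗ delta A2))
  ltac:(rewrite phi_S2VK).
sw_step (((e2 h' : k) *: \sw[A1]_(a, x <- h) (a *_[A1] S1 x)) ⊗ delta A2)
  ltac:(rewrite (antip_antipode HQ1 _).1).
by norm_both; rewrite [X in _ = X *: _]mulrC.
Qed.

(** Here the [H1] legs collapse first, by [phi_psiS]; then [psi_S1K] leaves S2(h'1) h'2. *)
Lemma bowtie_antipl x : tsum (fun a b => hantip B a *_[B] b) (tcomul A1 A2 x) =
  (tcounit A1 A2 x : k) *: delta B.
Proof.
move: x; apply: tensor_ext; [lin|lin|] => h h'.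
rewrite delta_bowtie.
sw_step (\sw[A1]_(a, x, b <- h) \sw[A2]_(u', y' <- h') \sw[A2]_(a', b' <- S2 u')
  ((\sw[A2]_(h'1, h'2 <- a') \sw[A1]_(h1, h2, h3 <- x)
    (phi (h'1 ⊗ S1 h2) *_[A1] phi (psi (h'2 ⊗ S1 h1) ⊗ h3))) ⊗
   (psi (psi (b' ⊗ S1 a) ⊗ b) *_[A2] y')))
  ltac:(rewrite phi_psiS).
sw_step (\sw[A2]_(u', y' <- h') (delta A1 ⊗
  ((\sw[A1]_(a, b <- h) psi (psi (S2 u' ⊗ S1 a) ⊗ b)) *_[A2] y')))
  ltac:(rewrite psi_S1K).
sw_step ((e1 h : k) *: (delta A1 ⊗ \sw[A2]_(u', y' <- h') (S2 u' *_[A2] y')))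
  ltac:(rewrite (antip_antipode HQ2 _).2).
by sweedler.
Qed.

(** Formally the product is (h'1 h1)(S1(h2) S2(h'2)), which cancels from the inside. The inner
    cancellation is [psi_S1VK] on the [H2] legs and [phi_psiVS] on the [H1] legs; the outer one is
    the antipode identity of [H2]. *)
Lemma exch_convr c :
  tsum (fun a b => exch a *_[B] tswap S2 S1 b) (tcomul A2 A1 c) =
  (tcounit A2 A1 c : k) *: delta B.
Proof.
move: c; apply: tensor_ext; [lin|lin|] => h' h.
rewrite delta_bowtie.
sw_step (\sw[A2]_(x', d' <- h') \sw[A2]_(a', b', c' <- x')
  \sw[A1]_(a, b, y <- h) \sw[A1]_(w, z <- y)
  ((phi (a' ⊗ a) *_[A1] phi (psi (b' ⊗ b) ⊗ S1 z)) ⊗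
   ((\sw[A1]_(s, t <- w) psi (psi (c' ⊗ s) ⊗ S1 t)) *_[A2] S2 d')))
  ltac:(rewrite psi_S1VK).
sw_step (\sw[A2]_(x', d' <- h') \sw[A2]_(y', c' <- x')
  ((\sw[A2]_(h'1, h'2 <- y') \sw[A1]_(h1, h2, h3 <- h)
    (phi (h'1 ⊗ h1) *_[A1] phi (psi (h'2 ⊗ h2) ⊗ S1 h3))) ⊗
   (c' *_[A2] S2 d')))
  ltac:(rewrite phi_psiVS).
sw_step ((e1 h : k) *: (delta A1 ⊗ \sw[A2]_(c', d' <- h') (c' *_[A2] S2 d')))
  ltac:(rewrite (antip_antipode HQ2 _).1).
by norm_both; rewrite [X in _ = X *: _]mulrC.
Qed.

Opaque exch.

Let bijS1 : bijective S1. Proof. by case: (antip_antiaut HQ1). Qed.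
Let bijS2 : bijective S2. Proof. by case: (antip_antiaut HQ2). Qed.

Lemma bowtie_antip_tswap x : hantip B x = exch (tswap S1 S2 x).
Proof.
move: x; apply: tensor_ext; [lin|lin|] => h h'.
by rewrite bowtie_antip_exch tswapE.
Qed.

(* [Pi] stands for [Si^m] and [Qi] for [Si^(m+1)], with m odd. *)
Section Powers.
Variables (P1 Q1 : {linear H1 -> H1}) (P2 Q2 : {linear H2 -> H2}).
Hypothesis P1_comul : forall h, hcomul A1 (P1 h) = \sw[A1]_(h1, h2 <- h) (P1 h2 ⊗ P1 h1).
Hypothesis P2_comul : forall h, hcomul A2 (P2 h) = \sw[A2]_(h1, h2 <- h) (P2 h2 ⊗ P2 h1).
Hypothesis Q1_comul : forall h, hcomul A1 (Q1 h) = \sw[A1]_(h1, h2 <- h) (Q1 h1 ⊗ Q1 h2).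
Hypothesis P1_counit : forall h, e1 (P1 h) = e1 h.
Hypothesis P2_counit : forall h, e2 (P2 h) = e2 h.
Hypothesis Q1_counit : forall h, e1 (Q1 h) = e1 h.
Hypothesis P1_delta : P1 (delta A1) = delta A1.
Hypothesis P2_delta : P2 (delta A2) = delta A2.
Hypothesis psi_inverse : forall h g h',
  \sw[A1]_(h1, h2 <- h) psi (psi (h' ⊗ P1 (h2 *_[A1] g)) ⊗ Q1 h1) =
  e1 h *: psi (h' ⊗ P1 g).
Hypothesis phi_inverse : forall h g h', e1 h *: phi (h' ⊗ P1 g) =
  \sw[A2]_(h'1, h'2 <- h') \sw[A1]_(h1, h2, h3 <- h) \sw[A1]_(g1, g2 <- g)
    (phi (h'1 ⊗ P1 (h3 *_[A1] g2)) *_[A1]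
     phi (psi (h'2 ⊗ P1 (h2 *_[A1] g1)) ⊗ Q1 h1)).
Hypothesis phi_cond : forall g h' g',
  \sw[A2]_(h'1, h'2 <- h') \sw[A1]_(g1, g2 <- g)
    phi (P2 (psi (h'2 ⊗ g2) *_[A2] g') ⊗ P1 (phi (h'1 ⊗ g1))) =
  e2 h' *: phi (P2 g' ⊗ P1 g).
Hypothesis psi_cond : forall g h' g',
  \sw[A2]_(h'1, h'2, h'3 <- h') \sw[A1]_(g1, g2 <- g)
    (psi (P2 (psi (h'3 ⊗ g2) *_[A2] g') ⊗ P1 (phi (h'2 ⊗ g1))) *_[A2] Q2 h'1) =
  e2 h' *: psi (P2 g' ⊗ P1 g).

Ltac sw_rules ::= first [ rewrite P1_comul | rewrite P2_comul | rewrite Q1_comul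
  | rewrite P1_counit | rewrite P2_counit | rewrite Q1_counit
  | rewrite P1_delta | rewrite P2_delta | exch_rules ].

(** This handles elements a ⊗ delta in the inverse identity: [psi_inverse] collapses some of the
    [psi] legs, then [phi_inverse] the rest. *)
Lemma exch_inversel a x y' :
  \sw[A1]_(a1, a2 <- a) (exch (y' ⊗ P1 (a2 *_[A1] x)) *_[B] (Q1 a1 ⊗ delta A2)) =
  (e1 a : k) *: exch (y' ⊗ P1 x).
Proof.
sw_step (\sw[A1]_(s, w, t <- a) \sw[A1]_(t1, t2 <- t) \sw[A1]_(x1, z <- x)
  \sw[A1]_(x2, x3 <- z) \sw[A2]_(y1, y2, y3 <- y')
  ((phi (y1 ⊗ P1 (t2 *_[A1] x3)) *_[A1]
    phi (psi (y2 ⊗ P1 (t1 *_[A1] x2)) ⊗ Q1 s)) ⊗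
   (\sw[A1]_(w1, w2 <- w) psi (psi (y3 ⊗ P1 (w2 *_[A1] x1)) ⊗ Q1 w1))))
  ltac:(rewrite psi_inverse).
sw_step (\sw[A1]_(x1, z <- x) \sw[A2]_(u, y3 <- y')
  ((\sw[A2]_(h'1, h'2 <- u) \sw[A1]_(h1, h2, h3 <- a) \sw[A1]_(g1, g2 <- z)
    (phi (h'1 ⊗ P1 (h3 *_[A1] g2)) *_[A1]
     phi (psi (h'2 ⊗ P1 (h2 *_[A1] g1)) ⊗ Q1 h1))) ⊗ psi (y3 ⊗ P1 x1)))
  ltac:(rewrite -phi_inverse).
by sweedler.
Qed.

(** The complementary case of elements delta ⊗ a', where the two odd conditions enter. [psi_phi_sym]
    first reorders the middle legs so that [phi_cond] applies; [psi_cond] then finishes. *)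
Lemma exch_inverser a' b b' :
  \sw[A2]_(a'1, a'2 <- a')
    (exch (tswap P1 P2 ((delta A1 ⊗ a'2) *_[B] (b ⊗ b'))) *_[B]
     (delta A1 ⊗ Q2 a'1)) =
  (e2 a' : k) *: exch (P2 b' ⊗ P1 b).
Proof.
sw_step (\sw[A2]_(c', s', x' <- a') \sw[A2]_(u', t' <- x')
  \sw[A1]_(s, y <- b) \sw[A1]_(u, t <- y) \sw[A2]_(b1, b2 <- b')
  \tsum_(p, q <- \sw[A2]_(u'1, u'2 <- u') \sw[A1]_(u1, u2 <- u)
    (psi (u'2 ⊗ u2) ⊗ phi (u'1 ⊗ u1)))
  (phi (P2 (psi (t' ⊗ t) *_[A2] b2) ⊗ P1 q) ⊗
   (psi (P2 (p *_[A2] b1) ⊗ P1 (phi (s' ⊗ s))) *_[A2] Q2 c')))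
  ltac:(rewrite -psi_phi_sym).
sw_step (\sw[A2]_(x', y' <- a') \sw[A2]_(c', s', t' <- x')
  \sw[A1]_(b1, b2 <- b) \sw[A1]_(u, t <- b1) \sw[A2]_(b'1, b'2 <- b')
  ((\sw[A2]_(h'1, h'2 <- y') \sw[A1]_(g1, g2 <- b2)
    phi (P2 (psi (h'2 ⊗ g2) *_[A2] b'2) ⊗ P1 (phi (h'1 ⊗ g1)))) ⊗
   (psi (P2 (psi (t' ⊗ t) *_[A2] b'1) ⊗ P1 (phi (s' ⊗ u))) *_[A2] Q2 c')))
  ltac:(rewrite phi_cond).
sw_step (\sw[A1]_(b1, b2 <- b) \sw[A2]_(b'1, b'2 <- b')
  (phi (P2 b'2 ⊗ P1 b2) ⊗
  \sw[A2]_(h'1, h'2, h'3 <- a') \sw[A1]_(g1, g2 <- b1)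
    (psi (P2 (psi (h'3 ⊗ g2) *_[A2] b'1) ⊗ P1 (phi (h'2 ⊗ g1))) *_[A2] Q2 h'1)))
  ltac:(rewrite psi_cond).
by sweedler.
Qed.

(** The closed form expected of S^m for m odd. It makes sense before S is known to be bijective. *)
Definition antip_pow_odd : {linear (H1 ⊗ H2)%type -> (H1 ⊗ H2)%type} :=
  exch \o tswap P1 P2.

Lemma antip_pow_oddE x : antip_pow_odd x = exch (tswap P1 P2 x).
Proof. by []. Qed.

(** A limited associativity: a left factor a ⊗ delta only multiplies the first leg by a, so nothing
    is reassociated inside [H1] or [H2]. *)
Lemma bowtie_mulAl a a' z :
  (a ⊗ a') *_[B] z = (a ⊗ delta A2) *_[B] ((delta A1 ⊗ a') *_[B] z).
Proof. by move: z; apply: tensor_ext; [lin|lin|] => b b'; sweedler. Qed.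

Lemma bowtie_mulAr z a a' :
  z *_[B] (a ⊗ a') = (z *_[B] (a ⊗ delta A2)) *_[B] (delta A1 ⊗ a').
Proof. by move: z; apply: tensor_ext; [lin|lin|] => b b'; sweedler. Qed.

Lemma bowtie_mul_inl a b b' :
  (a ⊗ delta A2) *_[B] (b ⊗ b') = (a *_[A1] b) ⊗ b'.
Proof. by sweedler. Qed.

Lemma antip_pow_odd_inversel a z : \sw[A1]_(a1, a2 <- a)
    (antip_pow_odd ((a2 ⊗ delta A2) *_[B] z) *_[B] (Q1 a1 ⊗ delta A2)) =
    (e1 a : k) *: antip_pow_odd z.
Proof.
move: z; apply: tensor_ext; [lin|lin|] => b b'.
rewrite [in RHS]antip_pow_oddE [in RHS]tswapE -exch_inversel.
apply: eq_tsum => a1 a2.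
by rewrite bowtie_mul_inl antip_pow_oddE tswapE.
Qed.

Lemma antip_pow_odd_inverser a' z : \sw[A2]_(a'1, a'2 <- a')
    (antip_pow_odd ((delta A1 ⊗ a'2) *_[B] z) *_[B] (delta A1 ⊗ Q2 a'1)) =
    (e2 a' : k) *: antip_pow_odd z.
Proof.
move: z; apply: tensor_ext; [lin|lin|] => b b'.
by rewrite [in RHS]antip_pow_oddE [in RHS]tswapE -exch_inverser.
Qed.

(** The limited associativity laws split off the factors a ⊗ delta and delta ⊗ a'. The sum over the
    legs of a then collapses inside, and the one over the legs of a' afterwards. *)
Lemma bowtie_inverse_odd x y :
  tsum (fun x1 x2 => antip_pow_odd (x2 *_[B] y) *_[B] tmap Q1 Q2 x1)
    (tcomul A1 A2 x) = (tcounit A1 A2 x : k) *: antip_pow_odd y.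
Proof.
move: x; apply: tensor_ext; [lin|lin|] => a a'.
transitivity (\sw[A2]_(a'1, a'2 <- a') ((\sw[A1]_(a1, a2 <- a)
    (antip_pow_odd ((a2 ⊗ delta A2) *_[B] ((delta A1 ⊗ a'2) *_[B] y)) *_[B]
      (Q1 a1 ⊗ delta A2))) *_[B] (delta A1 ⊗ Q2 a'1))).
  rewrite tcomulE tsum_tsum; [|lin|lin].
  under eq_tsum => a1 a2.
    rewrite tsum_tsum; [|lin|lin].
    under eq_tsum => a'1 a'2.
      rewrite tsumE; [|lin|lin].
      rewrite tmapE (bowtie_mulAl a2 a'2) (bowtie_mulAr _ (Q1 a1)).
    over.
  over.
  rewrite /= exchange_tsum; apply: eq_tsum => a'1 a'2.
  by rewrite tensl_tsum linear_tsumE.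
under eq_tsum => a'1 a'2 do rewrite antip_pow_odd_inversel tensZl linear_scaleE.
rewrite scaler_tsum antip_pow_odd_inverser scalerA tcounitE.
by [].
Qed.

Lemma antip_pow_odd_delta : antip_pow_odd (delta B) = delta B.
Proof.
rewrite delta_bowtie antip_pow_oddE tswapE P1_delta P2_delta.
by rewrite -exch_mul -delta_bowtie bowtie_unitl.
Qed.

Lemma antip_pow_odd_antip x : antip_pow_odd (hantip B x) = tmap Q1 Q2 x.
Proof.
apply: (antipode_inverse (A := B) coB bowtie_unitl antip_pow_odd_delta
  bowtie_inverse_odd); exact: bowtie_antipr.
Qed.

Lemma antip_pow_odd_tswap c : antip_pow_odd (tswap S2 S1 c) = tmap Q1 Q2 (exch c).
Proof.
exact: (right_convolution_inverse (A := B) bowtie_unitl antip_pow_odd_delta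
  bowtie_inverse_odd (coalgebra_tensor co2 co1) exch_comul exch_counit exch_convr).
Qed.

Hypothesis Q2_counit : forall h, e2 (Q2 h) = e2 h.
Hypothesis bijP1 : bijective P1.
Hypothesis bijP2 : bijective P2.
Hypothesis bijQ1 : bijective Q1.
Hypothesis bijQ2 : bijective Q2.

(** The relation T S = T' reads: [exch], precomposed with [tswap], composed with itself in this
    form, is the bijection [tmap Q1 Q2]. The outer [exch] is thus surjective and the inner one
    injective. *)
Lemma exch_bij : bijective exch.
Proof.
have [E EK KE] := tmap_bij bijQ1 bijQ2.
have [N NK KN] := tswap_bij bijS1 bijS2.
have exchK x : exch (tswap P1 P2 (exch (tswap S1 S2 x))) = tmap Q1 Q2 x.
  by rewrite -bowtie_antip_tswap -antip_pow_odd_antip.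
(* Solving this relation for the inner [exch] gives the left inverse. *)
pose G z := tswap S1 S2 (E (exch (tswap P1 P2 z))).
have GK : cancel exch G.
  by move=> y; rewrite /G -[in LHS](KN y) exchK EK KN.
(* The relation puts [z] in the image of [exch], where a left inverse is also a right inverse. *)
exists G => // z; rewrite -[z]KE -exchK.
by rewrite GK.
Qed.

Lemma bowtie_antip_bij_odd : bijective (hantip B).
Proof.
apply: (eq_bij (bij_comp exch_bij (tswap_bij bijS1 bijS2))) => x /=.
by rewrite bowtie_antip_tswap.
Qed.

(** Both sides have the same image under the injective T, namely [tmap Q1 Q2 (exch c)]. *)
Lemma bowtie_antip_exchK_odd c : hantip B (exch c) = tswap S2 S1 c.
Proof.
have injT := bij_inj (bij_comp exch_bij (tswap_bij bijP1 bijP2)).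
by apply: injT; rewrite /= -!antip_pow_oddE antip_pow_odd_antip antip_pow_odd_tswap.
Qed.

Ltac sw_rules ::= first [ rewrite P1_comul | rewrite P2_comul | rewrite Q1_comul
  | rewrite P1_counit | rewrite P2_counit | rewrite Q1_counit | rewrite Q2_counit
  | rewrite P1_delta | rewrite P2_delta | exch_rules ].

Lemma conditions_of_inverse :
  (forall a' b b', \sw[A2]_(a'1, a'2 <- a')
    (exch (tswap P1 P2 ((delta A1 ⊗ a'2) *_[B] (b ⊗ b'))) *_[B]
     (delta A1 ⊗ Q2 a'1)) = (e2 a' : k) *: exch (P2 b' ⊗ P1 b)) ->
  forall g h' g',
  \sw[A2]_(h'1, h'2 <- h') \sw[A1]_(g1, g2 <- g)
    phi (P2 (psi (h'2 ⊗ g2) *_[A2] g') ⊗ P1 (phi (h'1 ⊗ g1))) =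
  e2 h' *: phi (P2 g' ⊗ P1 g) /\
  \sw[A2]_(h'1, h'2, h'3 <- h') \sw[A1]_(g1, g2 <- g)
    (psi (P2 (psi (h'3 ⊗ g2) *_[A2] g') ⊗ P1 (phi (h'2 ⊗ g1))) *_[A2] Q2 h'1) =
  e2 h' *: psi (P2 g' ⊗ P1 g).
Proof.
move=> inv g h' g'.
(* [L1] and [L2] are id ⊗ eps and eps ⊗ id; each projects the identity to one of the two
   conditions. *)
pose L1 (t : H1 ⊗ H2) := \tsum_(x, y <- t) ((e2 y : k) *: x).
pose L2 (t : H1 ⊗ H2) := \tsum_(x, y <- t) ((e1 x : k) *: y).
have /(congr1 L1) E1 := inv h' g g'; have /(congr1 L2) E2 := inv h' g g'.
split.
- transitivity (L1 (\sw[A2]_(a'1, a'2 <- h')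
    (exch (tswap P1 P2 ((delta A1 ⊗ a'2) *_[B] (g ⊗ g'))) *_[B]
     (delta A1 ⊗ Q2 a'1)))); first by rewrite /L1; sweedler.
  by rewrite E1 /L1 tsumZ; [congr (_ *: _); sweedler|lin|lin].
- transitivity (L2 (\sw[A2]_(a'1, a'2 <- h')
    (exch (tswap P1 P2 ((delta A1 ⊗ a'2) *_[B] (g ⊗ g'))) *_[B]
     (delta A1 ⊗ Q2 a'1)))); first by rewrite /L2; sweedler.
  by rewrite E2 /L2 tsumZ; [congr (_ *: _); sweedler|lin|lin].
Qed.

End Powers.

(* As above, with m even. *)
Section EvenPowers.
Variables (P1 Q1 : {linear H1 -> H1}) (P2 Q2 : {linear H2 -> H2}).
Hypothesis P1_counit : forall h, e1 (P1 h) = e1 h.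
Hypothesis P2_counit : forall h, e2 (P2 h) = e2 h.
Hypothesis Q1_counit : forall h, e1 (Q1 h) = e1 h.
Hypothesis Q2_counit : forall h, e2 (Q2 h) = e2 h.
Hypothesis P1_delta : P1 (delta A1) = delta A1.
Hypothesis P2_delta : P2 (delta A2) = delta A2.

Section Trivial.
Hypothesis phi_trivial : forall h' h, phi (h' ⊗ h) = e2 h' *: h.
Hypothesis psi_trivial : forall h' h, psi (h' ⊗ h) = e1 h *: h'.
Hypothesis P1_inverse : forall h g,
  \sw[A1]_(h1, h2 <- h) (P1 (h2 *_[A1] g) *_[A1] Q1 h1) = e1 h *: P1 g.
Hypothesis P2_inverse : forall h g,
  \sw[A2]_(h1, h2 <- h) (P2 (h2 *_[A2] g) *_[A2] Q2 h1) = e2 h *: P2 g.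

Ltac sw_rules ::= first [ rewrite phi_trivial | rewrite psi_trivial
  | rewrite P1_counit | rewrite P2_counit | rewrite Q1_counit | rewrite Q2_counit
  | exch_rules ].

Lemma exch_trivial h' h : exch (h' ⊗ h) = h ⊗ h'.
Proof. by sweedler. Qed.

Lemma bowtie_antip_trivial x : hantip B x = tmap S1 S2 x.
Proof.
move: x; apply: tensor_ext; [lin|lin|] => h h'.
by rewrite bowtie_antip_exch exch_trivial tmapE.
Qed.

Lemma bowtie_antip_exchK_trivial c : hantip B (exch c) = tswap S2 S1 c.
Proof.
move: c; apply: tensor_ext; [lin|lin|] => h' h.
by rewrite exch_trivial bowtie_antip_trivial tmapE tswapE.
Qed.

Lemma bowtie_inverse_even x y :
  tsum (fun x1 x2 => tmap P1 P2 (x2 *_[B] y) *_[B] tmap Q1 Q2 x1)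
    (tcomul A1 A2 x) = (tcounit A1 A2 x : k) *: tmap P1 P2 y.
Proof.
move: x; apply: tensor_ext; [lin|lin|] => a a'.
move: y; apply: tensor_ext; [lin|lin|] => b b'.
sw_step ((\sw[A1]_(h1, h2 <- a) (P1 (h2 *_[A1] b) *_[A1] Q1 h1)) ⊗
   (\sw[A2]_(h1, h2 <- a') (P2 (h2 *_[A2] b') *_[A2] Q2 h1)))
  ltac:(rewrite P1_inverse P2_inverse).
by sweedler.
Qed.

End Trivial.

(** The scalar acts trivially on [H2] as well, because [psi_deltar] recovers h' from h' ⊗
    [delta A1]. *)
Lemma counit_delta1Z2 (h' : H2) : (e1 (delta A1) : k) *: h' = h'.
Proof.
rewrite -[in RHS](psi_deltar h') -[in RHS](counit_deltaZ HQ1 (delta A1)).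
by rewrite tensZr linear_scaleE psi_deltar.
Qed.

Lemma counit_delta2Z1 (h : H1) : (e2 (delta A2) : k) *: h = h.
Proof.
rewrite -[in RHS](phi_deltal h) -[in RHS](counit_deltaZ HQ2 (delta A2)).
by rewrite tensZl linear_scaleE phi_deltal.
Qed.

Hypothesis bijP1 : bijective P1.
Hypothesis bijP2 : bijective P2.
Hypothesis bijQ1 : bijective Q1.
Hypothesis bijQ2 : bijective Q2.
Hypothesis Q1_delta : Q1 (delta A1) = delta A1.
Hypothesis Q2_delta : Q2 (delta A2) = delta A2.

Hypothesis inverse_even : forall x y,
  tsum (fun x1 x2 => tmap P1 P2 (x2 *_[B] y) *_[B] exch (tswap Q1 Q2 x1))
    (tcomul A1 A2 x) = (tcounit A1 A2 x : k) *: tmap P1 P2 y.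

Ltac sw_rules ::= first [ rewrite P1_delta | rewrite P2_delta
  | rewrite Q1_delta | rewrite Q2_delta
  | rewrite P1_counit | rewrite P2_counit | rewrite Q1_counit | rewrite Q2_counit
  | exch_rules ].

Lemma inverse_even_phi h' h : phi (h' ⊗ h) = e2 h' *: h.
Proof.
pose L (t : H1 ⊗ H2) := \tsum_(x, y <- t) ((e2 y : k) *: x).
(* At these arguments the projection id ⊗ eps leaves only [P1 (phi (h' ⊗ h))] on the left, and [P1]
   is injective. *)
have /(congr1 L) := inverse_even (delta A1 ⊗ h') (h ⊗ delta A2).
have -> : L (tsum (fun x1 x2 => tmap P1 P2 (x2 *_[B] (h ⊗ delta A2)) *_[B]
      exch (tswap Q1 Q2 x1)) (tcomul A1 A2 (delta A1 ⊗ h'))) =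
    P1 (phi (h' ⊗ h)).
  by rewrite /L; sweedler.
rewrite tcounitE tmapE P2_delta /L tsumZ; [|lin|lin].
rewrite tsumE; [|lin|lin].
rewrite -scalerA !(counit_deltaZ HQ1) counit_delta2Z1 => E.
by apply: (bij_inj bijP1); rewrite linear_scaleE.
Qed.

Lemma inverse_even_psi h' h : psi (h' ⊗ h) = e1 h *: h'.
Proof.
(* Preimages under [P2] and [Q1] are inserted so that the powers cancel and [psi (h' ⊗ h)]
   remains. *)
have [P2' _ P2K] := bijP2; have [Q1' _ Q1K] := bijQ1.
pose L (t : H1 ⊗ H2) := \tsum_(x, y <- t) ((e1 x : k) *: y).
have /(congr1 L) := inverse_even (Q1' h ⊗ delta A2) (delta A1 ⊗ P2' h').
have -> : L (tsum (fun x1 x2 => tmap P1 P2 (x2 *_[B] (delta A1 ⊗ P2' h')) *_[B]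
      exch (tswap Q1 Q2 x1)) (tcomul A1 A2 (Q1' h ⊗ delta A2))) =
    psi (P2 (P2' h') ⊗ Q1 (Q1' h)).
  by rewrite /L; norm_both; rewrite counit_delta1Z2.
rewrite tcounitE tmapE P1_delta /L tsumZ; [|lin|lin].
rewrite tsumE; [|lin|lin].
rewrite mulrC -scalerA !(counit_deltaZ HQ2) counit_delta1Z2 -(Q1_counit (Q1' h)).
by rewrite Q1K P2K.
Qed.

End EvenPowers.

(** * Powers of the bowtie antipode and the quasigroup axioms *)

Local Notation S1pow m := (lzpow bijS1 m).
Local Notation S2pow m := (lzpow bijS2 m).

(** S is [exch] after a flip, while S after [exch] is a flip. Successive powers therefore gain and
    lose one [exch]. *)
Lemma bowtie_zpow : bijective (hantip B) ->
  (forall c, hantip B (exch c) = tswap S2 S1 c) ->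
  forall m x, zpow (hantip B) m x =
    if odd `|m|%N then exch (tswap (S1pow m) (S2pow m) x)
    else tmap (S1pow m) (S2pow m) x.
Proof.
move=> bijSB exchK; apply: (zpow_unique bijSB).
  have tmap0 x : tmap (S1pow 0) (S2pow 0) x = x.
    by move: x; apply: tensor_ext; [lin|lin|] => h h'; rewrite tmapE.
  exact: tmap0.
move=> m x; rewrite odd_absS if_neg; case: ifP => _.
  rewrite exchK; move: x; apply: tensor_ext; [lin|lin|] => h h'.
  by rewrite !tswapE tmapE !lzpowE !zpowS.
rewrite bowtie_antip_tswap; congr (exch _).
move: x; apply: tensor_ext; [lin|lin|] => h h'.
by rewrite tswapE tmapE tswapE !lzpowE !zpowS.
Qed.

Lemma bowtie_antip_delta : hantip B (delta B) = delta B.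
Proof.
by rewrite delta_bowtie bowtie_antip_exch S1_delta S2_delta -exch_mul -delta_bowtie
  bowtie_unitl.
Qed.

(** Collects what both parities share; [T] and [T'] are the closed forms of S^m and S^(m+1). *)
Lemma bowtie_quasigroup (m : int) (T T' : {linear (H1 ⊗ H2)%type -> (H1 ⊗ H2)%type}) :
  bijective (hantip B) ->
  (forall x, T x = zpow (hantip B) m x) ->
  (forall x, T' x = zpow (hantip B) (m + 1) x) ->
  (forall x y, tsum (fun x1 x2 => T (x2 *_[B] y) *_[B] T' x1) (tcomul A1 A2 x) =
    (tcounit A1 A2 x : k) *: T y) ->
  inverse_hopf_quasigroup m B.
Proof.
move=> bijSB TE TE' invT.
have T_delta : T (delta B) = delta B by rewrite TE zpow_fixed // bowtie_antip_delta.
have injT : injective T.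
  by move=> x y; rewrite !TE; apply: (bij_inj (zpow_bij bijSB m)).
have antipodeS : antipode_for B (hantip B).
  by move=> x; split; [exact: bowtie_antipr|exact: bowtie_antipl].
split.
- exact: bowtie_unitl.
- exact: bowtie_unitr.
- exact: (coassoc coB).
- exact: (counitl coB).
- exact: (counitr coB).
- exact: bowtie_comul_mul.
- exact: bowtie_counit_mul.
- by split; [|exact: bowtie_antip_comul|exact: bowtie_antip_counit].
- exact: antipodeS.
(* Composing [T] with a competing antipode or with S gives [T'] in both cases, and [T] is
   injective. *)
- move=> T0 _ T0P x; apply: injT.
  have Tg := antipode_inverse (A := B) coB bowtie_unitl T_delta invT.
  by rewrite !Tg // => h; [case: (antipodeS h)|case: (T0P h)].
- move=> x y; rewrite -TE -invT; apply: eq_tsum => x1 x2.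
  by rewrite !TE !TE'.
Qed.

(** Here S^m itself can serve as T: it sends S1(h) ⊗ S2(h') to S^(m+1) of [exch (h' ⊗ h)], and S^m
    cancels. *)
Lemma quasigroup_bowtie_antip_exch (m : int) : inverse_hopf_quasigroup m B ->
  forall c, hantip B (exch c) = tswap S2 S1 c.
Proof.
move=> HQ; have [bijSB _ _] := antip_antiaut HQ.
have invT x y : \sw[B]_(x1, x2 <- x)
   (lzpow bijSB m (x2 *_[B] y) *_[B] lzpow bijSB (m + 1) x1) =
   hcounit B x *: lzpow bijSB m y by exact: antip_inverse HQ x y.
have T_delta : lzpow bijSB m (delta B) = delta B.
  by rewrite lzpowE zpow_fixed // bowtie_antip_delta.
move=> c; apply: (bij_inj (zpow_bij bijSB m)).
have := right_convolution_inverse bowtie_unitl T_delta invT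
  (coalgebra_tensor co2 co1) exch_comul exch_counit exch_convr c.
by rewrite !lzpowE => ->; rewrite zpowD.
Qed.

(** * The two parities of the exponent *)

Section MainCases.
Variable m : int.
Hypothesis psi_inverse_mod : forall h g h',
  \sw[A1]_(h1, h2 <- h)
    psi (psi (h' ⊗ zpow S1 m (h2 *_[A1] g)) ⊗ zpow S1 (m + 1) h1) =
  e1 h *: psi (h' ⊗ zpow S1 m g).
Hypothesis phi_inverse_mod : forall h g h',
  e1 h *: phi (h' ⊗ zpow S1 m g) =
  if odd `|m|%N then
    \sw[A2]_(h'1, h'2 <- h') \sw[A1]_(h1, h2, h3 <- h) \sw[A1]_(g1, g2 <- g)
      (phi (h'1 ⊗ zpow S1 m (h3 *_[A1] g2)) *_[A1]
       phi (psi (h'2 ⊗ zpow S1 m (h2 *_[A1] g1)) ⊗ zpow S1 (m + 1) h1))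
  else
    \sw[A2]_(h'1, h'2 <- h') \sw[A1]_(h1, h2, h3 <- h) \sw[A1]_(g1, g2 <- g)
      (phi (h'1 ⊗ zpow S1 m (h2 *_[A1] g1)) *_[A1]
       phi (psi (h'2 ⊗ zpow S1 m (h3 *_[A1] g2)) ⊗ zpow S1 (m + 1) h1)).
Hypothesis inverse1 : forall h g,
  \sw[A1]_(h1, h2 <- h) (zpow S1 m (h2 *_[A1] g) *_[A1] zpow S1 (m + 1) h1) =
  e1 h *: zpow S1 m g.
Hypothesis inverse2 : forall h g,
  \sw[A2]_(h1, h2 <- h) (zpow S2 m (h2 *_[A2] g) *_[A2] zpow S2 (m + 1) h1) =
  e2 h *: zpow S2 m g.

Let anti1 := antip_antiaut HQ1.
Let anti2 := antip_antiaut HQ2.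

Let c1 n h : e1 (S1pow n h) = e1 h. Proof. by rewrite lzpowE (zpow_counit anti1). Qed.
Let c2 n h : e2 (S2pow n h) = e2 h. Proof. by rewrite lzpowE (zpow_counit anti2). Qed.
Let d1 n : S1pow n (delta A1) = delta A1. Proof. by rewrite lzpowE zpow_fixed. Qed.
Let d2 n : S2pow n (delta A2) = delta A2. Proof. by rewrite lzpowE zpow_fixed. Qed.
Let b1 n : bijective (S1pow n). Proof. exact: zpow_bij. Qed.
Let b2 n : bijective (S2pow n). Proof. exact: zpow_bij. Qed.

Lemma counit_delta1Z_bowtie (x : H1 ⊗ H2) : (e1 (delta A1) : k) *: x = x.
Proof.
move: x; apply: tensor_ext; [lin|lin|] => h h'.
by rewrite -tensZl (counit_deltaZ HQ1).
Qed.

(** For m even, the closed forms of S^m and S^(m+1) let well-chosen arguments force both actions to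
    be trivial. Conversely, trivial actions make [exch] the flip, and the inverse identity splits
    into those of the factors. *)
Lemma bowtie_quasigroup_even : ~~ odd `|m|%N ->
  inverse_hopf_quasigroup m B <->
  (forall h h', phi (h' ⊗ h) = e2 h' *: h /\ psi (h' ⊗ h) = e1 h *: h').
Proof.
move=> even_m; have odd_m1 : odd `|(m + 1)%R|%N by rewrite odd_absS.
split=> [HQ h h'|triv].
- have exchK := quasigroup_bowtie_antip_exch HQ.
  have [bijSB _ _] := antip_antiaut HQ.
  have inv x y : tsum (fun x1 x2 => tmap (S1pow m) (S2pow m) (x2 *_[B] y) *_[B]
      exch (tswap (S1pow (m + 1)) (S2pow (m + 1)) x1)) (tcomul A1 A2 x) =
    (tcounit A1 A2 x : k) *: tmap (S1pow m) (S2pow m) y.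
    have := antip_inverse HQ x y; rewrite (bowtie_zpow bijSB exchK) (negPf even_m).
    move=> <-; apply: eq_tsum => x1 x2.
    by rewrite !(bowtie_zpow bijSB exchK) (negPf even_m) odd_m1.
  split.
  + by apply: (inverse_even_phi (P1 := S1pow m) (Q1 := S1pow (m + 1))
      (P2 := S2pow m) (Q2 := S2pow (m + 1))).
  + by apply: (inverse_even_psi (P1 := S1pow m) (Q1 := S1pow (m + 1))
      (P2 := S2pow m) (Q2 := S2pow (m + 1))).
- have phi_triv h' h : phi (h' ⊗ h) = e2 h' *: h by case: (triv h h').
  have psi_triv h' h : psi (h' ⊗ h) = e1 h *: h' by case: (triv h h').
  have exchK := bowtie_antip_exchK_trivial phi_triv psi_triv.
  have bijSB : bijective (hantip B).
    apply: (eq_bij (tmap_bij bijS1 bijS2)) => x.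
    by rewrite (bowtie_antip_trivial phi_triv psi_triv).
  have zE := bowtie_zpow bijSB exchK.
  apply: (@bowtie_quasigroup _ (tmap (S1pow m) (S2pow m))
    (tmap (S1pow (m + 1)) (S2pow (m + 1))) bijSB) => x.
  + by rewrite zE (negPf even_m).
  + rewrite zE odd_m1; move: x; apply: tensor_ext; [lin|lin|] => h h'.
    by rewrite tmapE tswapE (exch_trivial phi_triv psi_triv).
  + by move=> y; apply: bowtie_inverse_even.
Qed.

(** The forward direction evaluates the inverse identity at delta ⊗ a'. The converse derives
    bijectivity of S and its powers from the conditions before the axioms are assembled. *)
Lemma bowtie_quasigroup_odd : odd `|m|%N ->
  inverse_hopf_quasigroup m B <->
  (forall (h g : H1) (h' g' : H2),
     \sw[A2]_(h'1, h'2 <- h') \sw[A1]_(g1, g2 <- g)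
       phi (zpow S2 m (psi (h'2 ⊗ g2) *_[A2] g') ⊗ zpow S1 m (phi (h'1 ⊗ g1)))
     = e2 h' *: phi (zpow S2 m g' ⊗ zpow S1 m g) /\
     \sw[A2]_(h'1, h'2, h'3 <- h') \sw[A1]_(g1, g2 <- g)
       (psi (zpow S2 m (psi (h'3 ⊗ g2) *_[A2] g') ⊗ zpow S1 m (phi (h'2 ⊗ g1)))
          *_[A2] zpow S2 (m + 1) h'1)
     = e2 h' *: psi (zpow S2 m g' ⊗ zpow S1 m g)).
Proof.
move=> odd_m; have even_m1 : odd `|(m + 1)%R|%N = false by rewrite odd_absS odd_m.
have P1_comul h : hcomul A1 (S1pow m h) = \sw[A1]_(h1, h2 <- h) (S1pow m h2 ⊗ S1pow m h1).
  by rewrite lzpowE (zpow_comul anti1) odd_m.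
have P2_comul h : hcomul A2 (S2pow m h) = \sw[A2]_(h1, h2 <- h) (S2pow m h2 ⊗ S2pow m h1).
  by rewrite lzpowE (zpow_comul anti2) odd_m.
have Q1_comul h : hcomul A1 (S1pow (m + 1) h) =
    \sw[A1]_(h1, h2 <- h) (S1pow (m + 1) h1 ⊗ S1pow (m + 1) h2).
  by rewrite lzpowE (zpow_comul anti1) even_m1.
split=> [HQ _ g h' g'|cond].
- have exchK := quasigroup_bowtie_antip_exch HQ.
  have [bijSB _ _] := antip_antiaut HQ.
  have zE := bowtie_zpow bijSB exchK.
  apply: (conditions_of_inverse (P1 := S1pow m) (P2 := S2pow m) (Q2 := S2pow (m + 1)))
    => //.
  move=> a' b b'.
  have := antip_inverse HQ (delta A1 ⊗ a') (b ⊗ b').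
  rewrite zE odd_m tswapE -[hcounit B]/(tcounit A1 A2) -[hcomul B]/(tcomul A1 A2).
  rewrite tcounitE mulrC -scalerA counit_delta1Z_bowtie => <-.
  rewrite tcomulE (comul_delta HQ1) tsumE; [|lin|lin].
  under [RHS]eq_tsum => x1 x2 do rewrite !zE odd_m even_m1.
  rewrite tsum_tsum; [|lin|lin]; apply: eq_tsum => a'1 a'2.
  by rewrite tsumE; [rewrite tmapE d1|lin|lin].
- have phi_inv h g h' : e1 h *: phi (h' ⊗ S1pow m g) =
    \sw[A2]_(h'1, h'2 <- h') \sw[A1]_(h1, h2, h3 <- h) \sw[A1]_(g1, g2 <- g)
      (phi (h'1 ⊗ S1pow m (h3 *_[A1] g2)) *_[A1]
       phi (psi (h'2 ⊗ S1pow m (h2 *_[A1] g1)) ⊗ S1pow (m + 1) h1)).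
    by have := phi_inverse_mod h g h'; rewrite odd_m.
  have phi_cond g h' g' := (cond g g h' g').1.
  have psi_cond g h' g' := (cond g g h' g').2.
  have bijSB : bijective (hantip B).
    apply: (@bowtie_antip_bij_odd (S1pow m) (S1pow (m + 1)) (S2pow m) (S2pow (m + 1))) => //.
  have exchK c : hantip B (exch c) = tswap S2 S1 c.
    apply: (@bowtie_antip_exchK_odd (S1pow m) (S1pow (m + 1)) (S2pow m) (S2pow (m + 1))) => //.
  have zE := bowtie_zpow bijSB exchK.
  apply: (@bowtie_quasigroup _ (antip_pow_odd (S1pow m) (S2pow m))
    (tmap (S1pow (m + 1)) (S2pow (m + 1))) bijSB) => x.
  + by rewrite zE odd_m.
  + by rewrite zE even_m1.
  + by move=> y; apply: bowtie_inverse_odd.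
Qed.

End MainCases.

(** [phi] receives the second legs because [S1] and [S2] reverse coproducts. *)
Lemma bowtie_antip_sum h h' : hantip B (h ⊗ h') =
  \sw[A2]_(h'1, h'2 <- h') \sw[A1]_(h1, h2 <- h)
    (phi (S2 h'2 ⊗ S1 h2) ⊗ psi (S2 h'1 ⊗ S1 h1)).
Proof. by rewrite bowtie_antip_exch exchE; sweedler. Qed.

End Bowtie.

Theorem proposition3p6 (k : fieldType) (H1 H2 : lmodType k)
    (A1 : hopf_ops H1) (A2 : hopf_ops H2) (m1 m2 r1 r2 : int)
    (HQ1 : inverse_hopf_quasigroup m1 A1)
    (S1_delta : hantip A1 (delta A1) = delta A1)
    (S1_aut : antip_pow_aut A1 r1)
    (HQ2 : inverse_hopf_quasigroup m2 A2)
    (S2_delta : hantip A2 (delta A2) = delta A2)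
    (S2_aut : antip_pow_aut A2 r2)
    (phi : {linear (H2 ⊗ H1)%type -> H1}) (psi : {linear (H2 ⊗ H1)%type -> H2}) :
  let S1 := hantip A1 in
  let S2 := hantip A2 in
  let e1 := hcounit A1 in
  let e2 := hcounit A2 in
  let admissible (m : int) := (m = m1 %[mod r1])%Z /\ (m = m2 %[mod r2])%Z in
  (* (1) *)
  (forall h : H1, phi (delta A2 ⊗ h) = h) ->
  (forall h' : H2, phi (h' ⊗ delta A1) = e2 h' *: delta A1) ->
  (forall h : H1, psi (delta A2 ⊗ h) = e1 h *: delta A2) ->
  (forall h' : H2, psi (h' ⊗ delta A1) = h') ->
  (* (2) *)
  (forall (h : H1) (h' : H2),
    \sw[A2]_(h'1, h'2 <- h') phi (S2 h'1 ⊗ phi (h'2 ⊗ h)) = e2 h' *: h /\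
    \sw[A2]_(h'1, h'2 <- h') phi (h'1 ⊗ phi (S2 h'2 ⊗ h)) = e2 h' *: h) ->
  (* (3) *)
  (forall m : int, admissible m -> forall (h g : H1) (h' : H2),
    \sw[A1]_(h1, h2 <- h)
      psi (psi (h' ⊗ zpow S1 m (h2 *_[A1] g)) ⊗ zpow S1 (m + 1) h1) =
    e1 h *: psi (h' ⊗ zpow S1 m g)) ->
  (* (4) *)
  (forall (h : H1) (h' : H2),
    \sw[A1]_(h1, h2 <- h) psi (psi (h' ⊗ S1 h1) ⊗ h2) = e1 h *: h' /\
    \sw[A1]_(h1, h2 <- h) psi (psi (h' ⊗ h1) ⊗ S1 h2) = e1 h *: h') ->
  (* (5) *)
  (forall (h : H1) (h' : H2),
    hcomul A1 (phi (h' ⊗ h)) =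
    \sw[A2]_(h'1, h'2 <- h') \sw[A1]_(h1, h2 <- h)
      (phi (h'1 ⊗ h1) ⊗ phi (h'2 ⊗ h2))) ->
  (forall (h : H1) (h' : H2), e1 (phi (h' ⊗ h)) = e1 h * e2 h') ->
  (* (6) *)
  (forall (h : H1) (h' : H2),
    hcomul A2 (psi (h' ⊗ h)) =
    \sw[A2]_(h'1, h'2 <- h') \sw[A1]_(h1, h2 <- h)
      (psi (h'1 ⊗ h1) ⊗ psi (h'2 ⊗ h2))) ->
  (forall (h : H1) (h' : H2), e2 (psi (h' ⊗ h)) = e1 h * e2 h') ->
  (* (7) *)
  (forall m : int, admissible m -> forall (h g : H1) (h' : H2),
    e1 h *: phi (h' ⊗ zpow S1 m g) =
    if odd `|m|%N then
      \sw[A2]_(h'1, h'2 <- h') \sw[A1]_(h1, h2, h3 <- h) \sw[A1]_(g1, g2 <- g)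
        (phi (h'1 ⊗ zpow S1 m (h3 *_[A1] g2)) *_[A1]
         phi (psi (h'2 ⊗ zpow S1 m (h2 *_[A1] g1)) ⊗ zpow S1 (m + 1) h1))
    else
      \sw[A2]_(h'1, h'2 <- h') \sw[A1]_(h1, h2, h3 <- h) \sw[A1]_(g1, g2 <- g)
        (phi (h'1 ⊗ zpow S1 m (h2 *_[A1] g1)) *_[A1]
         phi (psi (h'2 ⊗ zpow S1 m (h3 *_[A1] g2)) ⊗ zpow S1 (m + 1) h1))) ->
  (* (8) *)
  (forall (h : H1) (h' : H2),
    \sw[A2]_(h'1, h'2 <- h') \sw[A1]_(h1, h2, h3 <- h)
      (phi (h'1 ⊗ S1 h2) *_[A1] phi (psi (h'2 ⊗ S1 h1) ⊗ h3)) =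
    (e1 h * e2 h') *: delta A1 /\
    \sw[A2]_(h'1, h'2 <- h') \sw[A1]_(h1, h2, h3 <- h)
      (phi (h'1 ⊗ h1) *_[A1] phi (psi (h'2 ⊗ h2) ⊗ S1 h3)) =
    (e1 h * e2 h') *: delta A1) ->
  (* (9) *)
  (forall (h : H1) (h' : H2),
    \sw[A2]_(h'1, h'2, h'3 <- h') \sw[A1]_(h1, h2 <- h)
      (psi (S2 h'1 ⊗ phi (h'2 ⊗ h1)) *_[A2] psi (h'3 ⊗ h2)) =
    (e1 h * e2 h') *: delta A2 /\
    \sw[A2]_(h'1, h'2, h'3 <- h') \sw[A1]_(h1, h2 <- h)
      (psi (h'1 ⊗ phi (S2 h'3 ⊗ h1)) *_[A2] psi (S2 h'2 ⊗ h2)) =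
    (e1 h * e2 h') *: delta A2) ->
  (* (10) *)
  (forall (h : H1) (h' : H2),
    \sw[A2]_(h'1, h'2 <- h') \sw[A1]_(h1, h2 <- h)
      (psi (h'1 ⊗ h1) ⊗ phi (h'2 ⊗ h2)) =
    \sw[A2]_(h'1, h'2 <- h') \sw[A1]_(h1, h2 <- h)
      (psi (h'2 ⊗ h2) ⊗ phi (h'1 ⊗ h1))) ->
  (* the two expressions for the antipode agree *)
  (forall (h : H1) (h' : H2),
    hantip (bowtie A1 A2 phi psi) (h ⊗ h') =
    \sw[A2]_(h'1, h'2 <- h') \sw[A1]_(h1, h2 <- h)
      (phi (S2 h'2 ⊗ S1 h2) ⊗ psi (S2 h'1 ⊗ S1 h1))) /\
  (forall m : int, admissible m ->
    (inverse_hopf_quasigroup m (bowtie A1 A2 phi psi) <->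
     if odd `|m|%N then
       forall (h g : H1) (h' g' : H2),
         \sw[A2]_(h'1, h'2 <- h') \sw[A1]_(g1, g2 <- g)
           phi (zpow S2 m (psi (h'2 ⊗ g2) *_[A2] g') ⊗ zpow S1 m (phi (h'1 ⊗ g1)))
         = e2 h' *: phi (zpow S2 m g' ⊗ zpow S1 m g) /\
         \sw[A2]_(h'1, h'2, h'3 <- h') \sw[A1]_(g1, g2 <- g)
           (psi (zpow S2 m (psi (h'3 ⊗ g2) *_[A2] g') ⊗ zpow S1 m (phi (h'2 ⊗ g1)))
              *_[A2] zpow S2 (m + 1) h'1)
         = e2 h' *: psi (zpow S2 m g' ⊗ zpow S1 m g)
     else
       forall (h : H1) (h' : H2),
         phi (h' ⊗ h) = e2 h' *: h /\ psi (h' ⊗ h) = e1 h *: h')).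
Proof.
move=> S1 S2 e1 e2 admissible phi_deltal phi_deltar psi_deltal psi_deltar
  phi_S2 psi_inverse psi_S1 phi_comul phi_counit psi_comul psi_counit phi_inverse
  phi_psi psi_phi psi_phi_sym.
have phi_S2VK h h' := (phi_S2 h h').2.
have psi_S1K h h' := (psi_S1 h h').1.
have psi_S1VK h h' := (psi_S1 h h').2.
have phi_psiS h h' := (phi_psi h h').1.
have phi_psiVS h h' := (phi_psi h h').2.
have psi_phiVS h h' := (psi_phi h h').2.
split=> [h h'|m adm]; first exact: (bowtie_antip_sum HQ1 HQ2).
(* The congruences carry the inverse properties of both factors to the common exponent [m]. *)
have inv1 := antip_inverse_mod HQ1 S1_aut adm.1.
have inv2 := antip_inverse_mod HQ2 S2_aut adm.2.
case: ifP => [odd_m|/negbT even_m].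
  apply: (bowtie_quasigroup_odd HQ1 HQ2) => //.
  - exact: psi_inverse.
  - exact: phi_inverse.
apply: (bowtie_quasigroup_even HQ1 HQ2) => //.
Qed.
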